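(* Let $(A,L)$ be an $LR_\infty[1]$ algebra, $P$ a graded $A$-module, $\nabla$ a left $(A,L)$-connection in $P$, and for $u_1,\dots,u_{k-1}\in S_A^\bullet L$, $\Omega\in\mathrm{Sym}_A(L,P)$, $k\ge 1$, put $$L_k^\nabla(u_1,\dots,u_{k-1}|\Omega):=-(-)^k[\cdots[[D_k^\nabla,i_{u_1}],i_{u_2}]\cdots,i_{u_{k-1}}]\,\Omega .$$ Then $L^\nabla:=L_1^\nabla+L_2^\nabla+\cdots$ is a (left) $(K,S_A^\bullet L)$-connection in $\mathrm{Sym}_A(L,P)$, whose curvature $J(L^\nabla)$ is given by $$J(L^\nabla)(u_1,\dots,u_{k-1}|\Omega)=-(-)^k[\cdots[[\mathcal J_k^\nabla,i_{u_1}],i_{u_2}]\cdots,i_{u_{k-1}}]\,\Omega .$$ Moreover, $$L^\nabla(u_1,\dots,u_{k-1}|i_u\Omega)=i_{\{u_1,\dots,u_{k-1},u\}}\Omega+(-)^{\chi}i_uL^\nabla(u_1,\dots,u_{k-1}|\Omega),\qquad \chi=\bar u(\bar u_1+\cdots+\bar u_{k-1}+1),$$ and $$L^\nabla(uu_1,u_2,\dots,u_{k-1}|\Omega)=(-)^u i_uL^\nabla(u_1,\dots,u_{k-1}|\Omega)+(-)^{\chi'}L^\nabla(u,u_2,\dots,u_{k-1}|i_{u_1}\Omega),\qquad \chi'=\bar u_1(\bar u_2+\cdots+\bar u_{k-1}),$$ for all symmetric tensors $u,u_1,\dots,u_{k-1}\in S_A^\bullet L$ and all $P$-valued forms $\O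mega$.
   Context: Conventions: $K$ is a field of characteristic $0$; graded means $\mathbb Z$-graded; $\bar v$ is the degree of a homogeneous element or map $v$, and bars are omitted in exponents of signs: $(-)^{v}=(-1)^{\bar v}$, $(-)^{vw}=(-1)^{\bar v\bar w}$. $[F,G]=F\circ G-(-)^{FG}G\circ F$ is the graded commutator. $S_{\ell,m}$ is the set of $(\ell,m)$-unshuffles, i.e. permutations $\pi$ of $\{1,\dots,\ell+m\}$ with $\pi(1)<\cdots<\pi(\ell)$ and $\pi(\ell+1)<\cdots<\pi(\ell+m)$ (sums over $S_{\ell,m}$ with $\ell<0$ or $m<0$ are zero). $\alpha(\pi,\boldsymbol v)$ is the Koszul sign: $v_{\pi(1)}\odot\cdots\odot v_{\pi(n)}=\alpha(\pi,\boldsymbol v)\,v_1\odot\cdots\odot v_n$ in the graded symmetric algebra. Multilinearity over a graded algebra and graded symmetry use the Koszul sign rule. $LR_\infty[1]$ algebra: let $A$ be an associative, graded commutative, unital $K$-algebra and $L$ a graded $A$-module. An $LR_\infty[1]$ algebra structure on $(A,L)$ is a degree $1$ multiderivation $\mathbb X=\mathbb X_1+\mathbb X_2+\cdots$ (formal infinite sum, no $0$-entry component), $\mathbb X_k=(X_k,\sigma_k)$, where $X_k:L^{\times k}\to L$ is graded symmetric, $K$-multilinear, of degree $1$, and $\sigma_k:L^{\times(k-1)}\to\mathrm{Der}A$ is graded symmetric, $A$-multilinear, of degree $1$ (write $\sigma_k(\xi_1,\dots,\xi_{k-1}|a)$ for $\sigma_k(\xi_1,\dots,\xi_{k-1})(a)$),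 with $$X_k(\xi_1,\dots,\xi_{k-1},a\xi_k)=\sigma_k(\xi_1,\dots,\xi_{k-1}|a)\,\xi_k+(-)^{(1+\xi_1+\cdots+\xi_{k-1})a}a\,X_k(\xi_1,\dots,\xi_k),$$ and such that for all $k$: (J1) $\sum_{i+j=k}\sum_{\pi\in S_{i,j}}\alpha(\pi,\boldsymbol\xi)X_{j+1}(X_i(\xi_{\pi(1)},\dots,\xi_{\pi(i)}),\xi_{\pi(i+1)},\dots,\xi_{\pi(i+j)})=0$, and (J2) $\sum_{i+j=k}\sum_{\pi\in S_{i,j-1}}\alpha(\pi,\boldsymbol\xi)\big[\sigma_{j+1}(X_i(\xi_{\pi(1)},\dots,\xi_{\pi(i)}),\xi_{\pi(i+1)},\dots,\xi_{\pi(k-1)}|a)+(-)^{\xi_{\pi(1)}+\cdots+\xi_{\pi(i)}}\sigma_{i+1}(\xi_{\pi(1)},\dots,\xi_{\pi(i)}|\sigma_j(\xi_{\pi(i+1)},\dots,\xi_{\pi(k-1)}|a))\big]=0$ (with $X_0=0$). Left connection: a left $(A,L)$-connection in $P$ is $\nabla=\nabla_1+\nabla_2+\cdots$, with $\nabla_k:L^{\times(k-1)}\to\mathrm{End}_KP$ graded symmetric, $A$-multilinear (for the $A$-module structure $(a\phi)(p)=a\phi(p)$), of degree $1$, with $\nabla_k(\xi_1,\dots,\xi_{k-1}|ap)=(-)^{(1+\xi_1+\cdots+\xi_{k-1})a}a\nabla_k(\xi_1,\dots,\xi_{k-1}|p)+\sigma_k(\xi_1,\dots,\xi_{k-1}|a)p$.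 Its curvature is $$J(\nabla)(\xi_1,\dots,\xi_{k-1}|p)=\sum_{i+j=k}\sum_{\pi\in S_{i,j-1}}\alpha(\pi,\boldsymbol\xi)\big[\nabla_{j+1}(X_i(\xi_{\pi(1)},\dots,\xi_{\pi(i)}),\xi_{\pi(i+1)},\dots,\xi_{\pi(k-1)}|p)+(-)^{\xi_{\pi(1)}+\cdots+\xi_{\pi(i)}}\nabla_{i+1}(\xi_{\pi(1)},\dots,\xi_{\pi(i)}|\nabla_j(\xi_{\pi(i+1)},\dots,\xi_{\pi(k-1)}|p))\big].$$ Forms: $\mathrm{Sym}_A(L,P)=\bigoplus_\ell\mathrm{Sym}_A^\ell(L,P)$, where $\mathrm{Sym}^\ell_A(L,P)$ is the space of $A$-multilinear graded symmetric maps $L^{\times\ell}\to P$ ($P$-valued $\ell$-forms). $D_k^\nabla$ maps $\ell$-forms to $(\ell+k-1)$-forms: $$(D_k^\nabla\Omega)(\xi_1,\dots,\xi_{\ell+k-1})=\sum_{\pi\in S_{k-1,\ell}}(-)^{\Omega(\xi_{\pi(1)}+\cdots+\xi_{\pi(k-1)})}\alpha(\pi,\boldsymbol\xi)\nabla_k(\xi_{\pi(1)},\dots,\xi_{\pi(k-1)}|\Omega(\xi_{\pi(k)},\dots,\xi_{\pi(\ell+k-1)}))-\sum_{\tau\in S_{k,\ell-1}}(-)^\Omega\alpha(\tau,\boldsymbol\xi)\Omega(X_k(\xi_{\tau(1)},\dots,\xi_{\tau(k)}),\xi_{\tau(k+1)},\dots,\xi_{\tau(\ell+k-1)}).$$ $D^\nabla=\sum_kD_k^\nabla$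 and $\mathcal J^\nabla=\frac12[D^\nabla,D^\nabla]=\sum_k\mathcal J^\nabla_k$, with $\mathcal J_k^\nabla=\frac12\sum_{i+j=k+1}[D_i^\nabla,D_j^\nabla]$ mapping $\ell$-forms to $(\ell+k-1)$-forms. Tensors: $S_A^\bullet L$ is the graded symmetric algebra of $L$ over $A$. For $u=\zeta_1\cdots\zeta_m\in S_A^mL$ and an $\ell$-form $\Omega$, $(i_u\Omega)(\xi_1,\dots,\xi_{\ell-m})=(-)^{u\Omega}\Omega(\zeta_1,\dots,\zeta_m,\xi_1,\dots,\xi_{\ell-m})$ (zero if $m>\ell$); for $a\in A=S^0_AL$, $i_a\Omega=a\Omega$. The brackets $\{u_1,\dots,u_k\}:=\Lambda_k(u_1,\dots,u_k)$ on $S_A^\bullet L$: $\Lambda_k$ is the unique graded symmetric, $K$-multilinear, degree $1$ map $(S_A^\bullet L)^{\times k}\to S_A^\bullet L$ that is a graded derivation in each argument, with $\Lambda_k(\xi_1,\dots,\xi_k)=X_k(\xi_1,\dots,\xi_k)$, $\Lambda_k(\xi_1,\dots,\xi_{k-1},a)=\sigma_k(\xi_1,\dots,\xi_{k-1}|a)$ for $\xi_i\in L$, $a\in A$, and vanishing when at least two arguments are in $A$. With these brackets $S_A^\bullet L$ is an $L_\infty[1]$ algebra, i.e. $(K,S_A^\bullet L)$ is an $LR_\infty[1]$ algebra (over $K$, with zero symbols); left $(K,S_A^\bullet L)$-connections and their curvature are understood accordingly (definitions above with $A,L,X_k,\sigma_k$ replaced by $K,S_A^\bullet L,\Lambda_k,0$).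 *)

(* Defs.v *)
From mathcomp Require Import all_boot all_order all_fingroup all_algebra.
From mathcomp Require Import boolp classical_sets functions.

Set Implicit Arguments.
Unset Strict Implicit.
Unset Printing Implicit Defensive.

Import Order.TTheory GRing.Theory Num.Theory.

Local Open Scope ring_scope.

(* A Z-graded K-module is given inside an ambient K-module as an independent
   family (V_d) of submodules; the graded module itself is the internal direct
   sum of the V_d.  The V_d need not span the ambient module: only homogeneous
   elements are ever considered, and every condition on a structure map
   concerns its values on homogeneous arguments only. *)
Record gradedModule (K : fieldType) := GradedModule {
  gm_sort :> lmodType K;
  gm_comp : int -> set gm_sort;
  gm_comp0 : forall d, gm_comp d 0;
  gm_compD : forall d c x y,
    gm_comp d x -> gm_comp d y -> gm_comp d (c *: x + y);
  gm_direct : forall (s : seq int) (f : int -> gm_sort), uniq s ->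
    (forall d, gm_comp d (f d)) -> \sum_(d <- s) f d = 0 ->
    forall d, d \in s -> f d = 0 }.
Arguments gm_comp {K} V d : rename.

Definition homog (K : fieldType) (V : gradedModule K) (x : V) : Prop :=
  exists d, gm_comp V d x.
Arguments homog {K} V x.

Definition homogl (K : fieldType) (V : gradedModule K) (s : seq V) : Prop :=
  forall x, x \in s -> homog V x.
Arguments homogl {K} V s.

(* The degree of a homogeneous element.  That of 0 is some arbitrary integer:
   it only enters through the sign of a vanishing term. *)
Definition deg (K : fieldType) (V : gradedModule K) (x : V) : int :=
  xget 0 [set d | gm_comp V d x].
Arguments deg {K} V x.

Definition sdeg (K : fieldType) (V : gradedModule K) (s : seq V) : int :=
  \sum_(x <- s) deg V x.
Arguments sdeg {K} V s.

Definition sgn (K : fieldType) (d : int) : K := (-1) ^ d.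
Arguments sgn {K} d.

(* Positions are numbered from 0; there are no unshuffles when i > n. *)
Definition unshuffle (n i : nat) (pi : 'S_n) : bool :=
  (i <= n)%N && [forall a : 'I_n, forall b : 'I_n,
    ((a < b)%N && ((b < i)%N || (i <= a)%N)) ==> (pi a < pi b)%N].

(* v_pi(1), ..., v_pi(n) *)
Definition permute (T : Type) (s : seq T) (pi : 'S_(size s)) : seq T :=
  [seq tnth (in_tuple s) (pi j) | j <- enum 'I_(size s)].

(* One factor for each pair of entries that are exchanged by pi. *)
Definition koszul (K : fieldType) (V : gradedModule K) (s : seq V)
    (pi : 'S_(size s)) : K :=
  \prod_(p : 'I_(size s) * 'I_(size s) | (p.1 < p.2)%N && (pi p.2 < pi p.1)%N)
    sgn (deg V (tnth (in_tuple s) (pi p.1)) * deg V (tnth (in_tuple s) (pi p.2))).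
Arguments koszul {K} V [s] pi.

(* A map of the form F : seq V -> W stands for the family of its restrictions
   to V^n, n >= 0. *)

Definition gsymmetric (K : fieldType) (V : gradedModule K) (W : lmodType K)
    (F : seq V -> W) : Prop :=
  forall s (pi : 'S_(size s)), homogl V s ->
    F (permute pi) = koszul V pi *: F s.
Arguments gsymmetric {K} V {W} F.

Definition multilinear (K : fieldType) (V : gradedModule K) (W : lmodType K)
    (F : seq V -> W) : Prop :=
  forall d s1 s2 c (x y : V), homogl V s1 -> homogl V s2 ->
    gm_comp V d x -> gm_comp V d y ->
    F (s1 ++ (c *: x + y) :: s2) = c *: F (s1 ++ x :: s2) + F (s1 ++ y :: s2).
Arguments multilinear {K} V {W} F.

Definition glinear (K : fieldType) (V : gradedModule K) (W : lmodType K)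
    (f : V -> W) : Prop :=
  forall d c (x y : V), gm_comp V d x -> gm_comp V d y ->
    f (c *: x + y) = c *: f x + f y.
Arguments glinear {K} V {W} f.

Record gcAlgebra (K : fieldType) := GcAlgebra {
  ga_sort :> algType K;
  ga_comp : int -> set ga_sort;
  ga_comp0 : forall d, ga_comp d 0;
  ga_compD : forall d (c : K) x y,
    ga_comp d x -> ga_comp d y -> ga_comp d (c *: x + y);
  ga_direct : forall (s : seq int) (f : int -> ga_sort), uniq s ->
    (forall d, ga_comp d (f d)) -> \sum_(d <- s) f d = 0 ->
    forall d, d \in s -> f d = 0;
  ga_one : ga_comp 0 1;
  ga_mul : forall d e x y,
    ga_comp d x -> ga_comp e y -> ga_comp (d + e) (x * y);
  ga_comm : forall d e x y,
    ga_comp d x -> ga_comp e y -> x * y = (sgn (d * e) : K) *: (y * x) }.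

Definition ga_gm (K : fieldType) (A : gcAlgebra K) : gradedModule K :=
  @GradedModule K (ga_sort A) (@ga_comp K A) (@ga_comp0 K A) (@ga_compD K A)
    (@ga_direct K A).
Coercion ga_gm : gcAlgebra >-> gradedModule.

Record gMod (K : fieldType) (A : gcAlgebra K) := GMod {
  gmod_gm :> gradedModule K;
  act : ga_sort A -> gmod_gm -> gmod_gm;
  act_linl : forall x (c : K) a b, act (c *: a + b) x = c *: act a x + act b x;
  act_linr : forall a (c : K) x y, act a (c *: x + y) = c *: act a x + act a y;
  act_one : forall x, act 1 x = x;
  act_mul : forall a b x, act (a * b) x = act a (act b x);
  act_comp : forall d e a x,
    gm_comp A d a -> gm_comp gmod_gm e x -> gm_comp gmod_gm (d + e) (act a x) }.

(* A scalar moved in front passes F, of degree e, and the arguments on its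
   left. *)
Definition amultilinear (K : fieldType) (A : gcAlgebra K) (L : gMod A)
    (W : lmodType K) (actW : A -> W -> W) (e : int) (F : seq L -> W) : Prop :=
  forall s1 s2 (a : A) (x : L),
    homogl L s1 -> homogl L s2 -> homog A a -> homog L x ->
    F (s1 ++ act a x :: s2)
    = sgn (deg A a * (e + sdeg L s1)) *: actW a (F (s1 ++ x :: s2)).
Arguments amultilinear {K A} L {W} actW e F.

Section Ground.
Variable K : fieldType.

Definition k_comp (d : int) : set K^o := [set x | d = 0 \/ x = 0].

Lemma k_comp0 d : k_comp d 0. Proof. by right. Qed.

Lemma k_compD d (c : K) x y :
  k_comp d x -> k_comp d y -> k_comp d (c *: x + y).
Proof.
move=> [->|->]; first by left.
by move=> [->|->]; [left | right; rewrite scaler0 addr0].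
Qed.

Lemma k_direct (s : seq int) (f : int -> K^o) : uniq s ->
  (forall d, k_comp d (f d)) -> \sum_(d <- s) f d = 0 ->
  forall d, d \in s -> f d = 0.
Proof.
move=> us fc f0 d ds; have [d0|//] := fc d; rewrite d0 in ds *.
move: f0; rewrite (big_rem 0) //= big_seq big1 ?addr0 // => e.
by rewrite mem_rem_uniq // inE => /andP[/eqP e0 _]; case: (fc e).
Qed.

Lemma k_one : k_comp 0 1. Proof. by left. Qed.

Lemma k_mul d e (x y : K^o) :
  k_comp d x -> k_comp e y -> k_comp (d + e) (x * y).
Proof.
move=> [->|->] [->|->]; rewrite ?mulr0 ?mul0r ?addr0; by [left | right].
Qed.

Lemma k_comm d e (x y : K^o) : k_comp d x -> k_comp e y ->
  x * y = (sgn (d * e) : K) *: (y * x).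
Proof.
move=> [->|->] [->|->]; rewrite ?(mulr0, mul0r, scaler0) //;
  by rewrite ?expr0z /sgn ?expr0z scale1r mulrC.
Qed.

Definition groundAlg : gcAlgebra K :=
  @GcAlgebra K K^o k_comp k_comp0 k_compD k_direct k_one k_mul k_comm.

Variable V : gradedModule K.

Definition k_act (c : K^o) (x : V) : V := (c : K) *: x.

Lemma k_act_linl x (c : K) (a b : K^o) :
  k_act (c *: a + b) x = c *: k_act a x + k_act b x.
Proof. by rewrite /k_act scalerDl scalerA. Qed.

Lemma k_act_linr a (c : K) x y : k_act a (c *: x + y) = c *: k_act a x + k_act a y.
Proof. by rewrite /k_act scalerDr !scalerA mulrC. Qed.

Lemma k_act_one x : k_act 1 x = x. Proof. exact: scale1r. Qed.

Lemma k_act_mul a b x : k_act (a * b) x = k_act a (k_act b x).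
Proof. by rewrite /k_act scalerA. Qed.

Lemma k_act_comp d e a x :
  k_comp d a -> gm_comp V e x -> gm_comp V (d + e) (k_act a x).
Proof.
move=> [->|->] xe; last by rewrite /k_act scale0r; apply: gm_comp0.
by rewrite add0r -[k_act a x]addr0; apply: gm_compD => //; apply: gm_comp0.
Qed.

Definition groundMod : gMod groundAlg :=
  @GMod K groundAlg V k_act k_act_linl k_act_linr k_act_one k_act_mul k_act_comp.

End Ground.
Arguments groundMod {K} V.

(* X s is X_k(s) with k = size s; symb s a is sigma_k(s | a) and
   nabla s p is nabla_k(s | p) with k = size s + 1. *)

(* Curvature of nabla with respect to the brackets X.  Here i ranges over
   0 <= i <= k - 1 = size s, the only values for which S_{i,j-1} is nonempty;
   the summand i = 0 of the first term involves X_0 = X [::]. *)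
Definition curv (K : fieldType) (L P : gradedModule K)
    (X : seq L -> L) (nabla : seq L -> P -> P) (s : seq L) (p : P) : P :=
  \sum_(i < (size s).+1) \sum_(pi : 'S_(size s) | unshuffle i pi)
    koszul L pi *:
      (nabla (X (take i (permute pi)) :: drop i (permute pi)) p
       + sgn (sdeg L (take i (permute pi))) *:
         nabla (take i (permute pi)) (nabla (drop i (permute pi)) p)).
Arguments curv {K} L P X nabla s p.

Record LRinfty (K : fieldType) (A : gcAlgebra K) (L : gMod A)
    (X : seq L -> L) (symb : seq L -> A -> A) : Prop := {
  lr_nil : X [::] = 0;
  lr_sym : gsymmetric L X;
  lr_lin : multilinear L X;
  lr_deg : forall s, homogl L s -> gm_comp L (1 + sdeg L s) (X s);
  symb_sym : forall a : A, homog A a -> gsymmetric L (fun s => symb s a);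
  symb_lin : forall a : A, homog A a -> multilinear L (fun s => symb s a);
  symb_alin : forall a : A, homog A a ->
    amultilinear L *%R 1 (fun s => symb s a);
  symb_deg : forall s (a : A), homogl L s -> homog A a ->
    gm_comp A (1 + sdeg L s + deg A a) (symb s a);
  symb_klin : forall s, homogl L s -> glinear A (symb s);
  symb_der : forall s (a b : A), homogl L s -> homog A a -> homog A b ->
    symb s (a * b)
    = symb s a * b + (sgn ((1 + sdeg L s) * deg A a) : K) *: (a * symb s b);
  lr_leibniz : forall s (a : A) x, homogl L s -> homog A a -> homog L x ->
    X (rcons s (act a x))
    = act (symb s a) x
      + sgn ((1 + sdeg L s) * deg A a) *: act a (X (rcons s x));
  lr_J1 : forall s, homogl L s ->
    \sum_(i < (size s).+1) \sum_(pi : 'S_(size s) | unshuffle i pi)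
      koszul L pi *: X (X (take i (permute pi)) :: drop i (permute pi)) = 0;
  (* the second Jacobi identity has the shape of a vanishing curvature *)
  lr_J2 : forall s (a : A), homogl L s -> homog A a -> curv L A X symb s a = 0 }.

Record connection (K : fieldType) (A : gcAlgebra K) (L : gMod A)
    (symb : seq L -> A -> A) (P : gMod A) (nabla : seq L -> P -> P) : Prop := {
  conn_sym : forall p : P, homog P p -> gsymmetric L (fun s => nabla s p);
  conn_lin : forall p : P, homog P p -> multilinear L (fun s => nabla s p);
  conn_alin : forall p : P, homog P p ->
    amultilinear L (@act K A P) 1 (fun s => nabla s p);
  conn_deg : forall s (p : P), homogl L s -> homog P p ->
    gm_comp P (1 + sdeg L s + deg P p) (nabla s p);
  conn_klin : forall s, homogl L s -> glinear P (nabla s);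
  conn_leibniz : forall s (a : A) (p : P), homogl L s -> homog A a -> homog P p ->
    nabla s (act a p)
    = sgn ((1 + sdeg L s) * deg A a) *: act a (nabla s p)
      + act (symb s a) p }.

Section Forms.
Variables (K : fieldType) (A : gcAlgebra K) (L P : gMod A).

(* A form Om = sum_l Om_l is a function on lists, its l-form component Om_l
   being the restriction to lists of length l.  Forms are functions of
   homogeneous arguments, and are normalized to 0 on all other lists, so that
   equality of functions is equality of forms. *)
Record is_form (d : int) (Om : seq L -> P) : Prop := {
  form_norm : forall s, ~ homogl L s -> Om s = 0;
  form_fin : exists N, forall s, (N <= size s)%N -> Om s = 0;
  form_deg : forall s, homogl L s -> gm_comp P (d + sdeg L s) (Om s);
  form_sym : gsymmetric L Om;
  form_lin : multilinear L Om;
  form_alin : amultilinear L (@act K A P) d Om }.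

Lemma act0r (W : gMod A) (a : A) : act a (0 : W) = 0.
Proof.
have := act_linr a 1 (0 : W) 0; rewrite scaler0 addr0 scale1r => /eqP.
by rewrite -subr_eq0 opprD addrA subrr sub0r oppr_eq0 => /eqP.
Qed.

Lemma form_comp0 d : is_form d (0 : seq L -> P).
Proof.
split.
- by [].
- by exists 0%N.
- by move=> s _; apply: gm_comp0.
- by move=> s pi _ /=; rewrite scaler0.
- by move=> e s1 s2 c x y _ _ _ _ /=; rewrite scaler0 addr0.
- by move=> s1 s2 a x _ _ _ _ /=; rewrite act0r scaler0.
Qed.

Lemma form_compD d c (Om Om' : seq L -> P) :
  is_form d Om -> is_form d Om' -> is_form d (c *: Om + Om').
Proof.
move=> [n1 [N1 f1] d1 s1 l1 a1] [n2 [N2 f2] d2 s2 l2 a2].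
have E s : (c *: Om + Om') s = c *: Om s + Om' s by [].
split.
- by move=> s hs; rewrite E n1 // n2 // scaler0 addr0.
- exists (maxn N1 N2) => s; rewrite geq_max => /andP[h1 h2].
  by rewrite E f1 // f2 // scaler0 addr0.
- by move=> s hs; rewrite E; apply: gm_compD; [apply: d1 | apply: d2].
- move=> s pi hs; rewrite !E s1 // s2 // scalerDr !scalerA.
  by rewrite [c * _]mulrC.
- move=> e t1 t2 b x y h1 h2 hx hy.
  rewrite !E (l1 e) // (l2 e) // !scalerDr !scalerA [c * b]mulrC addrACA.
  by rewrite !addrA.
- move=> t1 t2 a x h1 h2 ha hx.
  rewrite !E a1 // a2 // act_linr scalerDr !scalerA.
  by rewrite [c * _]mulrC.
Qed.

Lemma form_direct (s : seq int) (f : int -> (seq L -> P)) : uniq s ->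
  (forall d, is_form d (f d)) -> \sum_(d <- s) f d = 0 ->
  forall d, d \in s -> f d = 0.
Proof.
move=> us hf f0 d ds; apply/funext => x /=.
case: (EM (homogl L x)) => hx; last exact: (form_norm (hf d)).
set c := sdeg L x.
have -> : f d x = (fun e => f (e - c) x) (d + c) by rewrite /= addrK.
apply: (@gm_direct K P [seq e + c | e <- s] (fun e => f (e - c) x)).
- by rewrite map_inj_uniq //; apply: addIr.
- by move=> e; rewrite -{1}[e](subrK c); apply: (form_deg (hf (e - c))).
- rewrite big_map; under eq_bigr do rewrite addrK.
  by move/(congr1 (fun g => g x)): f0; rewrite fct_sumE.
- exact: map_f.
Qed.

Definition Forms : gradedModule K :=
  @GradedModule K (seq L -> P) is_form form_comp0 form_compD form_direct.

Variables (X : seq L -> L) (nabla : seq L -> P -> P).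

(* For k >= 1.  On lists of length n the formula involves the component of Om
   of form degree l = n - k + 1. *)
Definition Dop (k : nat) (Om : Forms) : Forms := fun s =>
  if `[< homogl L s >] then
    \sum_(pi : 'S_(size s) | unshuffle k.-1 pi)
      (sgn (deg Forms Om * sdeg L (take k.-1 (permute pi))) * koszul L pi) *:
        nabla (take k.-1 (permute pi)) (Om (drop k.-1 (permute pi)))
    - \sum_(tau : 'S_(size s) | unshuffle k tau)
      (sgn (deg Forms Om) * koszul L tau) *:
        Om (X (take k (permute tau)) :: drop k (permute tau))
  else 0.

(* graded commutator of operators F, G of degrees dF, dG *)
Definition gcomm (dF dG : int) (F G : Forms -> Forms) : Forms -> Forms :=
  fun Om => F (G Om) - sgn (dF * dG) *: G (F Om).

Definition Jop (k : nat) (Om : Forms) : Forms :=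
  (2%:R^-1 : K) *: \sum_(1 <= i < k.+1) gcomm 1 1 (Dop i) (Dop (k.+1 - i)) Om.

(* [...[[F, i_u1], i_u2] ..., i_un] for F of degree dF *)
Fixpoint icomm (S : gradedModule K) (ins : S -> Forms -> Forms)
    (dF : int) (F : Forms -> Forms) (us : seq S) : Forms -> Forms :=
  if us is u :: us' then
    icomm ins (dF + deg S u) (gcomm dF (deg S u) F (ins u)) us'
  else F.

Definition Lconn (S : gradedModule K) (ins : S -> Forms -> Forms)
    (us : seq S) (Om : Forms) : Forms :=
  - ((-1) ^+ (size us).+1 : K) *: icomm ins 1 (Dop (size us).+1) us Om.

End Forms.
Arguments icomm {K A L P} S ins dF F us.
Arguments Lconn {K A L P} X nabla S ins us Om.

Record gAlgHom (K : fieldType) (A B : gcAlgebra K) (f : A -> B) : Prop := {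
  gh_lin : glinear A f;
  gh_deg : forall d a, gm_comp A d a -> gm_comp B d (f a);
  gh_one : f 1 = 1;
  gh_mul : forall a b : A, homog A a -> homog A b -> f (a * b) = f a * f b }.

(* degree 0 maps g from the A-module L to an algebra B that are A-linear along
   f : A -> B *)
Record gModHom (K : fieldType) (A : gcAlgebra K) (L : gMod A) (B : gcAlgebra K)
    (f : A -> B) (g : L -> B) : Prop := {
  mh_lin : glinear L g;
  mh_deg : forall d x, gm_comp L d x -> gm_comp B d (g x);
  mh_act : forall (a : A) (x : L), homog A a -> homog L x ->
    g (act a x) = f a * g x }.

(* The graded symmetric algebra of L over A, through its universal property. *)
Record symAlgebra (K : fieldType) (A : gcAlgebra K) (L : gMod A) := SymAlgebra {
  sa_alg :> gcAlgebra K;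
  sa_A : A -> sa_alg;
  sa_L : L -> sa_alg;
  sa_A_hom : gAlgHom sa_A;
  sa_L_hom : gModHom sa_A sa_L;
  sa_ex : forall (B : gcAlgebra K) (f : A -> B) (g : L -> B),
    gAlgHom f -> gModHom f g ->
    exists h : sa_alg -> B, [/\ gAlgHom h,
      forall a : A, homog A a -> h (sa_A a) = f a &
      forall x : L, homog L x -> h (sa_L x) = g x];
  sa_uniq : forall (B : gcAlgebra K) (h h' : sa_alg -> B),
    gAlgHom h -> gAlgHom h' ->
    (forall a : A, homog A a -> h (sa_A a) = h' (sa_A a)) ->
    (forall x : L, homog L x -> h (sa_L x) = h' (sa_L x)) ->
    forall u : sa_alg, homog sa_alg u -> h u = h' u }.

(* u |-> i_u.  The products of elements of L and the elements of A span S. *)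
Record insertion (K : fieldType) (A : gcAlgebra K) (L P : gMod A)
    (S : symAlgebra L) (ins : S -> Forms L P -> Forms L P) : Prop := {
  ins_lin : forall Om : Forms L P, homog (Forms L P) Om ->
    glinear S (fun u => ins u Om);
  ins_A : forall (a : A) (Om : Forms L P), homog A a -> homog (Forms L P) Om ->
    ins (sa_A S a) Om = (fun s => act a (Om s)) :> (seq L -> P);
  ins_L : forall (zs : seq L) (Om : Forms L P), homogl L zs -> homog (Forms L P) Om ->
    ins (\prod_(z <- zs) sa_L S z) Om
    = (fun s => sgn (sdeg L zs * deg (Forms L P) Om) *: Om (zs ++ s)) :> (seq L -> P) }.

(* Lam us is the bracket {us} = Lambda_k(us), k = size us >= 1. *)
Record bracket (K : fieldType) (A : gcAlgebra K) (L : gMod A)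
    (X : seq L -> L) (symb : seq L -> A -> A)
    (S : symAlgebra L) (Lam : seq S -> S) : Prop := {
  br_nil : Lam [::] = 0;
  br_sym : gsymmetric S Lam;
  br_lin : multilinear S Lam;
  br_deg : forall us : seq S, homogl S us ->
    gm_comp S (1 + sdeg S us) (Lam us);
  br_der : forall (us vs : seq S) (u v : S),
    homogl S us -> homogl S vs -> homog S u -> homog S v ->
    Lam (us ++ (u * v) :: vs)
    = (sgn (deg S v * sdeg S vs) : K) *: (Lam (us ++ u :: vs) * v)
      + (sgn ((1 + sdeg S us) * deg S u) : K) *: (u * Lam (us ++ v :: vs));
  br_X : forall s : seq L, homogl L s -> Lam (map (sa_L S) s) = sa_L S (X s);
  br_symb : forall (s : seq L) (a : A), homogl L s -> homog A a ->
    Lam (rcons (map (sa_L S) s) (sa_A S a)) = sa_A S (symb s a);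
  br_AA : forall (us vs ws : seq S) (a b : A),
    homogl S us -> homogl S vs -> homogl S ws -> homog A a -> homog A b ->
    Lam (us ++ sa_A S a :: vs ++ sa_A S b :: ws) = 0 }.

(* Main.v *)
(** A sum over unshuffles is a sum over the splittings of a list into two
    subsequences, which has a recursion on the list.  If an operator sends Omega
    to the form s |-> sum of phi_Omega(a, b) over the splittings (a, b) of s,
    where phi_Omega evaluates Omega on b only, then in its commutator with
    i_zeta the splittings that put zeta into b cancel and those that put zeta
    into a remain.  Iterating this for D_k gives, for u_1, ..., u_k in L or A,

      [...[D_k, i_u1] ..., i_uk] = - (-1)^k i_{u_1, ..., u_k},

    and this extends to all symmetric tensors because both sides are derivations
    in every argument.  The rest is formal.  The commutators with the i_u are
    commuting derivations, so the iterated commutator of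
    J_k = sum_(i + j = k + 1) D_i D_j is a sum over splittings (a, b) of the u's
    in which D_i meets a and D_j meets b.  Only i = |a|, |a| + 1, |a| + 2 survive;
    the middle term is the composite in the curvature, and the other two combine
    into the commutator of an operator D with i_{a}, i.e. into the term with
    the bracket as first argument. *)
From Pilot Require Import Defs.
From mathcomp Require Import all_boot all_order all_fingroup all_algebra.
From mathcomp Require Import boolp classical_sets functions.
From mathcomp Require Import ring zify.

Set Implicit Arguments.
Unset Strict Implicit.
Unset Printing Implicit Defensive.

Import Order.TTheory GRing.Theory Num.Theory.
(* for [act], which all_fingroup shadows *)
Import Pilot.Defs.

Local Open Scope ring_scope.

(** Why exactly three indices survive: k commutators with insertions turn D_k into an insertion, and
    insertions commute, so any further commutator is 0. A nonzero term therefore has |a| <= i and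
    |b| <= j; since |a| + |b| = k - 1 and i + j = k + 1, the difference i - |a| is 0, 1 or 2. At the
    two ends one of the factors is saturated and has become the insertion of a bracket.

    Two obstacles shape the details. The degree of 0 is arbitrary, so a sign can be recomputed only
    in front of a term that vanishes with the element concerned; hence the explicit degree
    parameters and the case distinctions at 0. And D_k of a form is A-multilinear only as a whole:
    the symbol produced by the Leibniz rule of the connection cancels the one produced by [X], and
    the two occur at different splittings of the same list. *)

(** * Signs and parities *)

Definition par (d : int) : bool := odd `|d|%N.

Lemma parD d e : par (d + e) = par d (+) par e.
Proof.
have abs2 (n : nat) (m : nat) : odd `|n%:Z - m%:Z|%N = odd n (+) odd m.
  case: (leqP m n) => h.
    by rewrite subzn // absz_nat oddB.
  by rewrite distnC subzn ?(ltnW h) // absz_nat oddB ?(ltnW h) // addbC.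
rewrite /par; case: (intP d) => [|n|n]; first by rewrite add0r.
  case: (intP e) => [|m|m]; first by rewrite addr0 addbF.
    by rewrite -PoszD !absz_nat oddD.
  by rewrite abs2 abszN.
case: (intP e) => [|m|m]; first by rewrite addr0 addbF.
  by rewrite addrC abs2 abszN addbC.
by rewrite -opprD !abszN -PoszD !absz_nat oddD.
Qed.

Lemma parM d e : par (d * e) = par d && par e.
Proof. by rewrite /par abszM oddM. Qed.

Lemma parN d : par (- d) = par d.
Proof. by rewrite /par abszN. Qed.

Lemma sgn_par (K : fieldType) d : sgn d = (if par d then -1 else 1) :> K.
Proof.
rewrite /sgn /par; case: d => n.
  by rewrite -exprnP -signr_odd absz_nat; case: odd; rewrite ?expr1 ?expr0.
rewrite NegzE abszN absz_nat -exprnN -signr_odd.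
by case: odd; rewrite ?expr1 ?expr0 ?invrN ?invr1.
Qed.

Lemma par0 : par 0 = false. Proof. by []. Qed.
Lemma par1 : par 1 = true. Proof. by []. Qed.
Definition parE := (sgn_par, parD, parM, parN, par0, par1).

(** A sign depends only on the parities of the degrees in its exponent. Once these are generalized
    to Booleans, a sign identity is a finite check. *)
Ltac sign_tac :=
  rewrite ?parE;
  repeat match goal with |- context[par ?x] =>
    let b := fresh "b" in generalize (par x) => b end;
  repeat match goal with b : bool |- _ => destruct b end;
  rewrite /= ?(mulN1r, mulrN1, mul1r, mulr1, opprK); try done.

Section Signs.
Variable K : fieldType.
Local Notation sgn := (@sgn K).

Lemma sgn0 : sgn 0 = 1. Proof. by rewrite sgn_par. Qed.
Lemma sgn1 : sgn 1 = -1. Proof. by rewrite sgn_par. Qed.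
Lemma sgnD d e : sgn (d + e) = sgn d * sgn e.
Proof. by sign_tac. Qed.
Lemma sgnn d : sgn d * sgn d = 1. Proof. by sign_tac. Qed.
End Signs.

(** * Graded modules, graded symmetry and sums over splittings *)

Section Graded.
Variables (K : fieldType) (V : gradedModule K).
Local Notation sgn := (@sgn K).

Lemma homog_comp d (x : V) : gm_comp V d x -> homog V x.
Proof. by exists d. Qed.

Lemma comp_deg (x : V) : homog V x -> gm_comp V (deg V x) x.
Proof. by case=> d hd; apply: (@xgetPex _ 0 [set d | gm_comp V d x]); exists d. Qed.

Lemma compZ d c (x : V) : gm_comp V d x -> gm_comp V d (c *: x).
Proof. by move=> hx; rewrite -[_ *: _]addr0; apply: gm_compD => //; apply: gm_comp0. Qed.

Lemma compN d (x : V) : gm_comp V d x -> gm_comp V d (- x).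
Proof. by rewrite -scaleN1r; apply: compZ. Qed.

Lemma compD d (x y : V) : gm_comp V d x -> gm_comp V d y -> gm_comp V d (x + y).
Proof. by move=> hx hy; rewrite -[x]scale1r; apply: gm_compD. Qed.

Lemma comp_uniq d e (x : V) : gm_comp V d x -> gm_comp V e x -> x != 0 -> d = e.
Proof.
move=> hd he; apply: contra_neq_eq => nde.
(* The relation x - x = 0, with x placed in degree d and - x in degree e, contradicts independence
   unless x = 0. *)
have := @gm_direct K V [:: d; e]
  (fun i => if i == d then x else if i == e then - x else 0) _ _ _ d.
rewrite eqxx; apply.
- by rewrite /= inE nde.
- move=> i; case: eqP => [->//|_]; case: eqP => [->|_]; first exact: compN.
  exact: gm_comp0.
- by rewrite !big_cons big_nil !eqxx eq_sym (negPf nde) addr0 subrr.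
- by rewrite inE eqxx.
Qed.

Lemma homog0 : homog V 0. Proof. by exists 0; apply: gm_comp0. Qed.

(* The degree of 0 is arbitrary, so a computed degree may only replace deg in
   front of a term that vanishes with x. *)
Lemma deg_subst (W : lmodType K) (w : W) d (x : V) (f : int -> K) :
  gm_comp V d x -> (x = 0 -> w = 0) -> f (deg V x) *: w = f d *: w.
Proof.
move=> hx w0; have [/w0 ->|nx] := eqVneq x 0; first by rewrite !scaler0.
by rewrite (comp_uniq (comp_deg (homog_comp hx)) hx nx).
Qed.

Lemma homogl_nil : homogl V [::]. Proof. by []. Qed.

Lemma homogl_cons x s : homogl V (x :: s) <-> homog V x /\ homogl V s.
Proof.
split=> [h|[hx hs] y]; last by rewrite inE => /orP[/eqP->|/hs].
by split=> [|y ys]; apply: h; rewrite inE ?eqxx ?ys ?orbT.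
Qed.

Lemma homogl_cat s t : homogl V (s ++ t) <-> homogl V s /\ homogl V t.
Proof.
split=> [h|[hs ht] y]; last by rewrite mem_cat => /orP[/hs|/ht].
by split=> y ys; apply: h; rewrite mem_cat ys ?orbT.
Qed.

Lemma sdeg_nil : sdeg V [::] = 0. Proof. exact: big_nil. Qed.
Lemma sdeg_cons x s : sdeg V (x :: s) = deg V x + sdeg V s.
Proof. exact: big_cons. Qed.
Lemma sdeg_cat s t : sdeg V (s ++ t) = sdeg V s + sdeg V t.
Proof. exact: big_cat. Qed.

(** Graded symmetry tested on adjacent transpositions only. In this form it can be proved by
    recursion on lists; [gsymmetric_swap] and [swap_gsymmetric] show that it is equivalent to
    [gsymmetric]. *)
Definition swap_symmetric (W : lmodType K) (F : seq V -> W) : Prop :=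
  forall s x y t, homogl V s -> homog V x -> homog V y -> homogl V t ->
    F (s ++ x :: y :: t) = sgn (deg V x * deg V y) *: F (s ++ y :: x :: t).

Lemma swap_front (W : lmodType K) (F : seq V -> W) s x t :
  swap_symmetric F -> homogl V s -> homog V x -> homogl V t ->
  F (s ++ x :: t) = sgn (deg V x * sdeg V s) *: F (x :: s ++ t).
Proof.
move=> symF; elim/last_ind: s t => [|s y IH] t hs hx ht.
  by rewrite sdeg_nil mulr0 sgn0 scale1r.
move: hs; rewrite -cats1 => /homogl_cat[hs /homogl_cons[hy _]].
rewrite -!catA /= symF // IH //; last exact/homogl_cons.
rewrite scalerA sdeg_cat sdeg_cons sdeg_nil.
by congr (_ *: _); sign_tac.
Qed.

Lemma swap_symmetric_cons (W : lmodType K) (F : seq V -> W) x :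
  homog V x -> swap_symmetric F -> swap_symmetric (fun s => F (x :: s)).
Proof.
by move=> hx symF s y z t hs *; rewrite -!cat_cons symF //; apply/homogl_cons.
Qed.

Lemma swap_blocks (W : lmodType K) (F : seq V -> W) s t u :
  swap_symmetric F -> homogl V s -> homogl V t -> homogl V u ->
  F (s ++ t ++ u) = sgn (sdeg V s * sdeg V t) *: F (t ++ s ++ u).
Proof.
move=> symF hs; elim: t F symF => [|y t IH] F symF ht hu.
  by rewrite sdeg_nil mulr0 sgn0 scale1r.
move: ht => /homogl_cons[hy ht].
rewrite cat_cons swap_front //; last exact/homogl_cat.
rewrite (IH (fun r => F (y :: r))) //; last exact: swap_symmetric_cons.
by rewrite scalerA sdeg_cons; congr (_ *: _); sign_tac.
Qed.

(* The Koszul-signed sum of f over all splittings of s into two subsequences. *)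
Fixpoint usum (W : lmodType K) (s : seq V) (f : seq V -> seq V -> W) : W :=
  if s is x :: s' then
    usum s' (fun a b => f (x :: a) b)
    + usum s' (fun a b => sgn (deg V x * sdeg V a) *: f a (x :: b))
  else f [::] [::].

(** A weak stand-in for complementary subsequences: homogeneity, total length and total degree are
    what the summands of [usum] are later judged by. *)
Definition splits (s a b : seq V) : Prop :=
  [/\ homogl V a, homogl V b, (size a + size b)%N = size s
    & sdeg V a + sdeg V b = sdeg V s].

Lemma splits_consl x s a b : homog V x -> splits s a b -> splits (x :: s) (x :: a) b.
Proof.
move=> hx [ha hb e1 e2]; split=> //; first exact/homogl_cons.
  by rewrite /= addSn e1.
by rewrite !sdeg_cons -addrA e2.
Qed.

Lemma splits_consr x s a b : homog V x -> splits s a b -> splits (x :: s) a (x :: b).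
Proof.
move=> hx [ha hb e1 e2]; split=> //; first exact/homogl_cons.
  by rewrite /= addnS e1.
by rewrite !sdeg_cons addrCA e2.
Qed.

Section Usum.
Variable W : lmodType K.
Implicit Types (s : seq V) (f g : seq V -> seq V -> W).

Lemma eq_usum s f g : homogl V s ->
  (forall a b, splits s a b -> f a b = g a b) -> usum s f = usum s g.
Proof.
elim: s f g => [|x s IH] f g hs fg /=; first by apply: fg; split=> //;
  rewrite !sdeg_nil addr0.
move: hs => /homogl_cons[hx hs]; congr (_ + _); apply: IH => // a b sab.
  by apply: fg; apply: splits_consl.
by rewrite fg //; apply: splits_consr.
Qed.

Lemma usum_closed (Q : W -> Prop) s f : homogl V s ->
  (forall c x y, Q x -> Q y -> Q (c *: x + y)) ->
  (forall a b, splits s a b -> Q (f a b)) -> Q (usum s f).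
Proof.
move=> hs0 QD Qf0.
have QD' x y : Q x -> Q y -> Q (x + y).
  by move=> hx hy; rewrite -[x]scale1r; apply: QD.
have QZ c x : Q x -> Q (c *: x).
  move=> hx; rewrite -[_ *: _]addr0; apply: (QD) => //.
  (* That [Q] holds at 0 comes from writing 0 as - x + x. *)
  by rewrite -(addNr x) -scaleN1r; apply: QD.
elim: s f hs0 Qf0 => [|x s IH] f hs Qf /=; first by apply: Qf; split=> //;
  rewrite !sdeg_nil addr0.
move: hs => /homogl_cons[hx hs]; apply: QD'; apply: IH => // a b sab.
  by apply: Qf; apply: splits_consl.
by apply/QZ/Qf; apply: splits_consr.
Qed.

Lemma usum_ext s f g : (forall a b, f a b = g a b) -> usum s f = usum s g.
Proof. by move=> fg; congr usum; apply/funext => a; apply/funext. Qed.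

Lemma usumP s c f g : usum s (fun a b => c *: f a b + g a b) = c *: usum s f + usum s g.
Proof.
elim: s f g => [//|x s IH] f g /=; rewrite IH scalerDr addrACA -!IH; congr (_ + _).
by apply: usum_ext => a b; rewrite scalerDr !scalerA [c * _]mulrC.
Qed.

Lemma usumD s f g : usum s (fun a b => f a b + g a b) = usum s f + usum s g.
Proof.
by rewrite -[usum s f]scale1r -usumP; apply: usum_ext => a b; rewrite scale1r.
Qed.

Lemma usum0 s : usum s (fun _ _ => 0) = 0 :> W.
Proof.
elim: s => [//|x s IH] /=; rewrite IH add0r -[RHS]IH.
by apply: usum_ext => a b; rewrite scaler0.
Qed.

Lemma usumZ s c f : usum s (fun a b => c *: f a b) = c *: usum s f.
Proof.
by rewrite -[RHS]addr0 -(usum0 s) -usumP; apply: usum_ext => a b; rewrite addr0.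
Qed.

Lemma usum_sum (I : Type) (r : seq I) (F : I -> seq V -> seq V -> W) s :
  usum s (fun a b => \sum_(i <- r) F i a b) = \sum_(i <- r) usum s (F i).
Proof.
elim: r => [|i r IH].
  by rewrite big_nil -[RHS](usum0 s); apply: usum_ext => a b; rewrite big_nil.
by rewrite big_cons -IH -usumD; apply: usum_ext => a b; rewrite big_cons.
Qed.

(** Collapses a sum whose summand dies as soon as its left block receives an entry; the surviving
    splitting carries the sign 1. *)
Lemma usum_nill s f : homogl V s ->
  (forall a b, splits s a b -> a <> [::] -> f a b = 0) -> usum s f = f [::] s.
Proof.
elim: s f => [//|x s IH] f /homogl_cons[hx hs] f0 /=.
rewrite (@eq_usum _ _ (fun _ _ => 0)) //; last first.
  by move=> a b sab; apply: f0 => //; apply: splits_consl.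
rewrite usum0 add0r IH //; first by rewrite sdeg_nil mulr0 sgn0 scale1r.
by move=> a b sab na; rewrite f0 ?scaler0 //; apply: splits_consr.
Qed.

Lemma usum_flip s f : homogl V s ->
  usum s f = usum s (fun a b => sgn (sdeg V a * sdeg V b) *: f b a).
Proof.
elim: s f => [|x s IH] f; first by rewrite /= sdeg_nil mulr0 sgn0 scale1r.
move=> /homogl_cons[hx hs] /=; rewrite addrC IH // [X in _ + X]IH //.
congr (_ + _); apply: eq_usum => // a b _; rewrite !scalerA sdeg_cons;
  by congr (_ *: _); sign_tac.
Qed.

(** When x and y lead the list, the splittings that put both on one side are handled by the symmetry
    of [f], and the two mixed ones trade places. Entries in front of x and y are absorbed into
    [f]. *)
Lemma usum_swap f :
  (forall b, homogl V b -> swap_symmetric (f^~ b)) ->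
  (forall a, homogl V a -> swap_symmetric (f a)) ->
  swap_symmetric (fun s => usum s f).
Proof.
move=> symf1 symf2 s.
elim: s f symf1 symf2 => [|z s IH] f sym1 sym2 x y t hs hx hy ht /=.
  rewrite -!usumD -usumZ; apply: eq_usum => // a b [ha hb _ _].
  have /= -> // := sym1 b hb [::] x y a.
  have /= -> // := sym2 a ha [::] x y b.
  rewrite [in RHS]addrACA !scalerDr !scalerA !sdeg_cons.
  congr (_ + _ + (_ + _)); congr (_ *: _); sign_tac.
move: hs => /homogl_cons[hz hs].
rewrite (IH (fun a => f (z :: a))) //; last 2 first.
- by move=> b hb; apply: (@swap_symmetric_cons _ (f^~ b)) => //; apply: sym1.
- by move=> a ha; apply: sym2; apply/homogl_cons.
rewrite (IH (fun a b => sgn (deg V z * sdeg V a) *: f a (z :: b))) //; last 2 first.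
- move=> b hb s1 u v t1 h1 hu hv ht1; rewrite sym1 //; last exact/homogl_cons.
  by rewrite !scalerA !sdeg_cat !sdeg_cons; congr (_ *: _); sign_tac.
- move=> a ha s1 u v t1 h1 hu hv ht1; rewrite (swap_symmetric_cons hz (sym2 a ha)) //.
  by rewrite !scalerA mulrC.
by rewrite scalerDr.
Qed.

End Usum.

End Graded.

(** * Koszul signs of unshuffles *)

Section Inversions.
Variables (K : fieldType) (dg : nat -> int).
Local Notation sgn := (@sgn K).

(** The Koszul sign of a word of positions: one factor for each inversion, collected at its left
    letter. Unlike a product over pairs of indices, it follows the recursion of the word. *)
Fixpoint inv_sign (l : seq nat) : K :=
  if l is x :: l' then
    \prod_(y <- l' | (y < x)%N) sgn (dg x * dg y) * inv_sign l'
  else 1.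

Lemma inv_sign_min x l : all (leq x) l -> inv_sign (x :: l) = inv_sign l.
Proof.
move=> /allP xl /=; rewrite big1_seq ?mul1r // => y /andP[yx /xl].
by rewrite leqNgt yx.
Qed.

Lemma inv_sign_sorted l : sorted ltn l -> inv_sign l = 1.
Proof.
elim: l => // x l IH xl; rewrite inv_sign_min ?IH //; first exact: path_sorted xl.
by apply: sub_all (order_path_min ltn_trans xl) => y /ltnW.
Qed.

(** The letter x is inverted with every letter of [l1] and with none of [l2], so removing it costs
    exactly these factors. *)
Lemma inv_sign_move l1 x l2 : all (ltn x) l1 -> all (leq x) l2 ->
  inv_sign (l1 ++ x :: l2)
  = sgn (dg x * \sum_(y <- l1) dg y) * inv_sign (l1 ++ l2).
Proof.
elim: l1 => [_ h|z l1 IH /=].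
  by rewrite cat0s inv_sign_min // big_nil mulr0 sgn0 mul1r.
move=> /andP[xz h1] h2; rewrite IH // !big_cat big_cons /= xz big_cons.
rewrite !mulrDr sgnD [dg z * _]mulrC; ring.
Qed.

Lemma inv_sign_prod n l : size l = n ->
  inv_sign l = \prod_(i < n) \prod_(j < n | (i < j)%N && (nth 0%N l j < nth 0%N l i)%N)
     sgn (dg (nth 0%N l i) * dg (nth 0%N l j)).
Proof.
elim: n l => [|n IH] [|x l] //=; first by rewrite big_ord0.
move=> [sl]; rewrite big_ord_recl (IH l) //; congr (_ * _).
  rewrite [RHS]big_mkcond big_ord_recl /= mul1r -big_mkcond /=.
  by rewrite (big_nth 0%N) big_mkord sl.
apply: eq_bigr => i _.
rewrite [RHS]big_mkcond big_ord_recl /= mul1r -big_mkcond /=.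
by apply: eq_bigl => j.
Qed.

End Inversions.

Section Permutations.
Variables (n : nat).

Definition perm_seq (pi : 'S_n) : seq nat := [seq val (pi j) | j <- enum 'I_n].

Lemma size_perm_seq pi : size (perm_seq pi) = n.
Proof. by rewrite size_map size_enum_ord. Qed.

Lemma nth_perm_seq pi (j : 'I_n) : nth 0%N (perm_seq pi) j = pi j.
Proof. by rewrite (nth_map j) ?size_enum_ord // nth_ord_enum. Qed.

Lemma perm_seq_inj : injective perm_seq.
Proof.
by move=> pi rho e; apply/permP => j; apply: ord_inj; rewrite -!nth_perm_seq e.
Qed.

Lemma perm_seq_iota pi : perm_eq (perm_seq pi) (iota 0 n).
Proof.
rewrite uniq_perm ?iota_uniq //.
  by rewrite map_inj_uniq ?enum_uniq // => x y /val_inj /perm_inj.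
move=> k; rewrite mem_iota /=; apply/mapP/idP => [[j _ ->]|kn]; first exact: ltn_ord.
by exists (pi^-1 (Ordinal kn))%g; rewrite ?mem_enum // permKV.
Qed.

Lemma perm_seq_surj l : perm_eq l (iota 0 n) -> exists pi, perm_seq pi = l.
Proof.
move=> ll; have sl : size l = n by rewrite (perm_size ll) size_iota.
have lt (j : 'I_n) : (nth 0%N l j < n)%N.
  have : nth 0%N l j \in l by rewrite mem_nth ?sl.
  by rewrite (perm_mem ll) mem_iota.
have inj : injective (fun j => Ordinal (lt j)).
  move=> i j /(congr1 val) /= /eqP; rewrite nth_uniq ?sl //.
    by move/eqP/val_inj.
  by rewrite (perm_uniq ll) iota_uniq.
exists (perm inj); apply: (@eq_from_nth _ 0%N); rewrite size_perm_seq ?sl //.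
by move=> k kn; rewrite (nth_perm_seq _ (Ordinal kn)) permE.
Qed.

Lemma unshuffle_sorted i pi :
  unshuffle i pi = [&& (i <= n)%N, sorted ltn (take i (perm_seq pi))
                     & sorted ltn (drop i (perm_seq pi))].
Proof.
rewrite /unshuffle; case: leqP => //= i_n.
have szt : size (take i (perm_seq pi)) = i.
  by rewrite size_takel // size_perm_seq.
apply/forallP/andP => [H|[s1 s2] a].
  have {}H (a b : nat) : (a < b < n)%N -> (b < i)%N || (i <= a)%N ->
      (nth 0 (perm_seq pi) a < nth 0 (perm_seq pi) b)%N.
    move=> /andP[ab bn] h; have an := ltn_trans ab bn.
    have /forallP/(_ (Ordinal bn)) := H (Ordinal an).
    by rewrite /= ab h /= -!nth_perm_seq.
  split; apply/(sortedP 0%N) => j; rewrite ?szt ?size_drop ?size_perm_seq => hj.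
    rewrite !nth_take ?(ltnW hj) //; apply: H; rewrite ?hj // ltnSn.
    exact: leq_trans hj i_n.
  rewrite !nth_drop addnS; apply: H; last by rewrite leq_addr orbT.
  by rewrite ltnSn /= -addnS -ltn_subRL.
apply/forallP => b; apply/implyP => /andP[ab /orP[bi|ia]]; rewrite -!nth_perm_seq.
  rewrite -(@nth_take i) ?(ltn_trans ab) // -[X in (_ < X)%N](@nth_take i) //.
  by apply: (sorted_ltn_nth ltn_trans) => //; rewrite inE szt ?(ltn_trans ab).
have ib := leq_trans ia (ltnW ab).
rewrite -(subnKC ia) -(subnKC ib) -!nth_drop.
apply: (sorted_ltn_nth ltn_trans) => //; rewrite ?inE ?size_drop ?size_perm_seq.
- by rewrite ltn_sub2r // (leq_ltn_trans ia).
- by rewrite ltn_sub2r // (leq_ltn_trans ib).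
- by rewrite ltn_sub2r // (leq_ltn_trans ia).
Qed.

End Permutations.

Section KoszulSign.
Variables (K : fieldType) (V : gradedModule K).
Local Notation degs s := (fun k => deg V (nth 0 s k)).

Lemma permuteE s (pi : 'S_(size s)) : permute pi = map (nth (0 : V) s) (perm_seq pi).
Proof. by rewrite /permute /perm_seq -map_comp; apply: eq_map => j /=;
  rewrite (tnth_nth 0). Qed.

Lemma koszulE s (pi : 'S_(size s)) :
  koszul V pi = inv_sign K (degs s) (perm_seq pi).
Proof.
rewrite (inv_sign_prod _ _ (size_perm_seq pi)) pair_big_dep /=.
apply: eq_big => [p|p _]; rewrite !nth_perm_seq ?(tnth_nth 0) //.
Qed.

(** The word of an adjacent transposition has a single inversion, so its Koszul sign is the one
    factor for x and y. *)
Lemma gsymmetric_swap (W : lmodType K) (F : seq V -> W) :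
  gsymmetric V F -> swap_symmetric F.
Proof.
move=> symF s x y t hs hx hy ht.
set r := s ++ y :: x :: t; set m := size s.
(* The word of the transposition of the positions m and m + 1, where y and x stand in [r]. *)
set l := iota 0 m ++ m.+1 :: m :: iota m.+2 (size t).
have nr : size r = (m + (size t).+2)%N by rewrite size_cat.
have lr : perm_eq l (iota 0 (size r)).
  rewrite nr iotaD add0n perm_cat2l.
  by rewrite (perm_catCA [:: m.+1] [:: m] (iota m.+2 (size t))).
have [pi pil] := perm_seq_surj lr.
have := symF r pi; rewrite permuteE koszulE pil.
have -> : map (nth 0 r) l = s ++ x :: y :: t.
  rewrite map_cat /= /r !nth_cat ltnNge leqnSn /= subSnn ltnn subnn /=.
  congr (_ ++ _ :: _ :: _).
    apply: (@eq_from_nth _ 0); rewrite size_map size_iota // => k km.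
    by rewrite (nth_map 0%N) ?size_iota // nth_iota // nth_cat km.
  apply: (@eq_from_nth _ 0); rewrite size_map size_iota // => k km.
  rewrite (nth_map 0%N) ?size_iota // nth_iota // nth_cat ltnNge.
  by rewrite !addSnnS leq_addr /= addKn.
move=> -> ; last first.
  by apply/homogl_cat; split=> //; apply/homogl_cons; split=> //; apply/homogl_cons.
have min a k u : all (leq (a + k)) u ->
    inv_sign K (degs r) (iota a k ++ u) = inv_sign K (degs r) u.
  elim: k a => [//|k IH] a; rewrite addnS => h.
  rewrite [_ ++ _]/= inv_sign_min ?IH // all_cat; apply/andP; split.
    by apply/allP => b; rewrite mem_iota => /andP[/ltnW].
  by apply: sub_all h => b /ltnW; apply: leq_trans; apply: leq_addr.
rewrite min /=; last first.
  by rewrite leqnSn leqnn; apply/allP => b; rewrite mem_iota => /andP[/ltnW/ltnW].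
(* The letters after the swapped pair are at least m + 2, hence never inverted with it. *)
have no (c : nat) : (c <= m.+2)%N ->
    \prod_(z <- iota m.+2 (size t) | (z < c)%N) sgn (degs r c * degs r z) = 1 :> K.
  move=> cm; rewrite big1_seq // => z /andP[zc]; rewrite mem_iota => /andP[mz _].
  by move: (leq_ltn_trans (leq_trans cm mz) zc); rewrite ltnn.
rewrite big_cons ltnSn (no m.+1 (leqnSn _)) (no m (leqW (leqnSn _))) !mulr1 mul1r
  inv_sign_sorted ?mulr1; last exact: iota_ltn_sorted.
by rewrite /r !nth_cat ltnNge leqnSn /= subSnn ltnn subnn.
Qed.

Lemma sdeg_map (s : seq V) l :
  sdeg V (map (nth 0 s) l) = \sum_(k <- l) deg V (nth 0 s k).
Proof. by rewrite /sdeg big_map. Qed.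

(** Selection sort: the least letter is brought to the front, and the sign paid by [F] in
    [swap_front] is the one that [inv_sign_move] takes off the word. *)
Lemma swap_symmetric_sort (W : lmodType K) (F : seq V -> W) s l t :
  swap_symmetric F -> homogl V s -> sorted ltn t -> all (gtn (size s)) t -> perm_eq l t ->
  F (map (nth 0 s) l) = inv_sign K (degs s) l *: F (map (nth 0 s) t).
Proof.
move=> + hs; elim: t l F => [|x t IH] l F symF st ts lt.
  by move: lt => /perm_nilP ->; rewrite scale1r.
have xl : x \in l by rewrite (perm_mem lt) inE eqxx.
have xt : all (ltn x) t := order_path_min ltn_trans st.
have hom u : {subset u <= l} -> homogl V (map (nth 0 s) u).
  move=> ul v /mapP[k /ul]; rewrite (perm_mem lt) => /(allP ts) /= ks ->.
  exact/hs/mem_nth.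
have hx : homog V (nth 0 s x) by apply/hs/mem_nth; case/andP: ts.
move: lt hom; case/splitPr: l / xl => l1 l2 lt hom.
have {}lt : perm_eq (l1 ++ l2) t.
  by rewrite -(perm_cons x); apply: perm_trans lt; rewrite (perm_catCA [:: x] l1 l2).
have xl : all (ltn x) (l1 ++ l2) by rewrite (perm_all _ lt).
have := xl; rewrite all_cat => /andP[xl1 xl2].
rewrite map_cat /= swap_front //; last 2 first.
- by apply: hom => k; rewrite mem_cat => ->.
- by apply: hom => k; rewrite mem_cat inE => ->; rewrite !orbT.
rewrite -map_cat (IH _ (fun u => F (nth 0 s x :: u))) //; last 3 first.
- exact: swap_symmetric_cons.
- exact: path_sorted st.
- by case/andP: ts.
rewrite scalerA sdeg_map inv_sign_move //.
by apply: sub_all xl2 => k /ltnW.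
Qed.

Lemma swap_gsymmetric (W : lmodType K) (F : seq V -> W) :
  swap_symmetric F -> gsymmetric V F.
Proof.
move=> symF s pi hs; rewrite permuteE koszulE.
rewrite (swap_symmetric_sort symF hs (iota_ltn_sorted 0 (size s)) _ (perm_seq_iota pi)).
  by rewrite map_nth_iota0 // take_size.
by apply/allP => k; rewrite mem_iota.
Qed.

End KoszulSign.

(** * Unshuffles as bit masks *)

Section UnshuffleSums.
Variables (K : fieldType) (V : gradedModule K).
Local Notation sgn := (@sgn K).

Fixpoint bitseqs n : seq bitseq :=
  if n is n'.+1 then map (cons true) (bitseqs n') ++ map (cons false) (bitseqs n')
  else [:: [::]].

Lemma mem_bitseqs n m : (m \in bitseqs n) = (size m == n).
Proof.
elim: n m => [|n IH] [|b m] //=.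
  by rewrite mem_cat; apply/norP; split; apply/mapP => -[].
rewrite mem_cat eqSS -IH; apply/orP/idP => [[] /mapP[m' ? [_ ->]] //|mn].
by case: b; [left | right]; apply/mapP; exists m.
Qed.

Lemma bitseqs_uniq n : uniq (bitseqs n).
Proof.
elim: n => //= n IH; rewrite cat_uniq !map_inj_uniq ?IH //=; try by move=> ? ? [].
by rewrite andbT; apply/hasPn => _ /mapP[m _ ->]; apply/mapP => -[].
Qed.

(** Each entry that is masked out pays for passing the later entries that are kept, as in the second
    term of [usum]. *)
Fixpoint mask_sign (m : bitseq) (s : seq V) : K :=
  match m, s with
  | b :: m', x :: s' =>
    (if b then 1 else sgn (deg V x * sdeg V (mask m' s'))) * mask_sign m' s'
  | _, _ => 1
  end.

Lemma usum_mask (W : lmodType K) s (f : seq V -> seq V -> W) :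
  usum s f = \sum_(m <- bitseqs (size s)) mask_sign m s *: f (mask m s) (mask (map negb
    m) s).
Proof.
elim: s f => [|x s IH] f /=; first by rewrite big_seq1 scale1r.
rewrite big_cat !big_map /= !IH; congr (_ + _); apply: eq_bigr => m _.
  by rewrite mul1r.
by rewrite scalerA mulrC.
Qed.

(** As [t] increases, the inversions of the concatenation are the pairs of a dropped letter and a
    kept letter to its right in [t]. *)
Lemma inv_sign_mask (s : seq V) (t : seq nat) m : sorted ltn t ->
  inv_sign K (fun k => deg V (nth 0 s k)) (mask m t ++ mask (map negb m) t)
  = mask_sign m (map (nth 0 s) t).
Proof.
elim: t m => [|k t IH] [|b m] //= kt.
have st := path_sorted kt; have kmin := order_path_min ltn_trans kt.
have allm u : all (ltn k) (mask u t) by apply/allP => j /mem_mask /(allP kmin).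
have leqm u : all (leq k) (mask u t) by apply: sub_all (allm u) => j /ltnW.
case: b => /=; first by rewrite -/(inv_sign _ _ (_ :: _)) inv_sign_min ?mul1r ?IH //
  all_cat !leqm.
by rewrite inv_sign_move // IH // -map_mask sdeg_map.
Qed.

(** Recovers a mask from the positions it selects, which makes the passage from masks to words
    injective in [unshuffle_usum]. *)
Lemma mask_iotaK n m : size m = n -> map (mem (mask m (iota 0 n))) (iota 0 n) = m.
Proof.
move=> sm; apply: (@eq_from_nth _ false); rewrite size_map size_iota ?sm // => k kn.
rewrite (nth_map 0%N) ?size_iota // nth_iota //= add0n.
rewrite in_mask ?iota_uniq // mem_iota kn /=; congr nth.
by rewrite -{1}[k]add0n -(nth_iota 0%N 0 kn) index_uniq ?size_iota ?iota_uniq.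
Qed.

(** An unshuffle is determined by the set of its first i values, that is, by a mask with i bits set.
    Both sides are rewritten as sums of one function [G] over words, and the two lists of words are
    compared. *)
Lemma unshuffle_usum (W : lmodType K) s i (f : seq V -> seq V -> W) :
  \sum_(pi : 'S_(size s) | unshuffle i pi)
     koszul V pi *: f (take i (permute pi)) (drop i (permute pi))
  = usum s (fun a b => if size a == i then f a b else 0).
Proof.
set n := size s.
pose G l := inv_sign K (fun k => deg V (nth 0 s k)) l *:
  f (take i (map (nth 0 s) l)) (drop i (map (nth 0 s) l)).
transitivity (\sum_(l <- map (@perm_seq n) [seq pi <- enum 'S_n | unshuffle i pi]) G l).
  rewrite big_map big_filter big_enum_cond /=.
  by apply: eq_bigr => pi _; rewrite /G permuteE koszulE.
pose ml m := mask m (iota 0 n) ++ mask (map negb m) (iota 0 n).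
have size_ml m : size m = n -> size (mask m (iota 0 n)) = count id m.
  by move=> sm; rewrite size_mask ?size_iota.
transitivity (\sum_(l <- map ml [seq m <- bitseqs n | count id m == i]) G l); last first.
  rewrite usum_mask big_map big_filter.
  rewrite [LHS]big_mkcond [LHS]big_seq [RHS]big_seq; apply: eq_bigr => m.
  rewrite mem_bitseqs => /eqP sm; rewrite size_mask //.
  case: eqP => [cm|]; last by rewrite scaler0.
  rewrite /G inv_sign_mask ?iota_ltn_sorted // map_nth_iota0 // take_size.
  have szm : size (map (nth 0 s) (mask m (iota 0 n))) = i.
    by rewrite size_map size_ml.
  rewrite map_cat -szm take_size_cat // drop_size_cat //.
  by rewrite !map_mask map_nth_iota0 // take_size.
(* Both lists of words are free of repetitions, so it remains to see that they have the same
   members. *)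
apply/perm_big/uniq_perm.
- by rewrite (map_inj_uniq (@perm_seq_inj n)) filter_uniq ?enum_uniq.
- rewrite map_inj_in_uniq ?filter_uniq ?bitseqs_uniq //.
  move=> m m'; rewrite !mem_filter !mem_bitseqs => /andP[/eqP cm /eqP sm].
  move=> /andP[/eqP cm' /eqP sm'] /eqP.
  rewrite /ml eqseq_cat ?size_ml ?cm ?cm' // => /andP[/eqP e _].
  by rewrite -(mask_iotaK sm) e mask_iotaK.
move=> l; apply/mapP/mapP => [[pi]|[m]].
  rewrite mem_filter unshuffle_sorted => /andP[/and3P[i_n st sd] _] ->.
  set t := take i _ in st *; set d := drop i _ in sd *.
  have td : perm_seq pi = t ++ d by rewrite cat_take_drop.
  have pit := perm_seq_iota pi.
  have utd : uniq (t ++ d) by rewrite -td (perm_uniq pit) iota_uniq.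
  (* The mask marks the values that [pi] takes on its first i positions. Each block of [pi] is
     increasing, so it is determined by its set of values. *)
  exists (map (mem t) (iota 0 n)); last first.
    rewrite td /ml -map_comp -!filter_mask; congr (_ ++ _).
      apply: (irr_sorted_eq ltn_trans ltnn) => //.
        exact: sorted_filter ltn_trans _ _ (iota_ltn_sorted _ _).
      move=> k; rewrite mem_filter -(perm_mem pit) td mem_cat /=.
      by case: (k \in t).
    apply: (irr_sorted_eq ltn_trans ltnn) => //.
      exact: sorted_filter ltn_trans _ _ (iota_ltn_sorted _ _).
    move=> k; rewrite mem_filter -(perm_mem pit) td mem_cat /=.
    move: utd; rewrite cat_uniq => /and3P[_ /hasPn h _].
    by case kd : (k \in d); [rewrite (negPf (h k kd)) orbT | rewrite orbF andNb].
  rewrite mem_filter mem_bitseqs size_map size_iota eqxx andbT.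
  rewrite count_map -size_filter.
  suff /perm_size -> : perm_eq [seq k <- iota 0 n | preim (mem t) id k] t.
    by rewrite size_takel ?size_perm_seq.
  apply: uniq_perm; rewrite ?filter_uniq ?iota_uniq //.
    by move: utd; rewrite cat_uniq => /andP[].
  move=> k; rewrite mem_filter -(perm_mem pit) td mem_cat /=.
  by case: (k \in t).
rewrite mem_filter mem_bitseqs => /andP[/eqP cm /eqP sm] ->.
have pml : perm_eq (ml m) (iota 0 n).
  rewrite /ml; have: size m = size (iota 0 n) by rewrite size_iota.
  elim: (iota 0 n) m {sm cm} => [|k u IH] [|b m] //= [sm].
  case: b => /=; first by rewrite perm_cons IH.
  by rewrite -cat1s perm_catCA /= perm_cons IH.
have [pi pim] := perm_seq_surj pml.
exists pi => //; rewrite mem_filter mem_enum andbT unshuffle_sorted pim /ml.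
have szm : size (mask m (iota 0 n)) = i by rewrite size_ml.
rewrite -{2 3}szm take_size_cat // drop_size_cat //.
rewrite !(sorted_mask ltn_trans) ?iota_ltn_sorted // !andbT.
by rewrite -cm -sm count_size.
Qed.

Lemma unshuffle_usum_all (W : lmodType K) s (f : seq V -> seq V -> W) : homogl V s ->
  \sum_(i < (size s).+1) \sum_(pi : 'S_(size s) | unshuffle i pi)
     koszul V pi *: f (take i (permute pi)) (drop i (permute pi))
  = usum s f.
Proof.
move=> hs; under eq_bigr do rewrite unshuffle_usum.
rewrite -usum_sum; apply: eq_usum => // a b [_ _ ab _].
have ha : (size a < (size s).+1)%N by rewrite ltnS -ab leq_addr.
rewrite (bigD1 (Ordinal ha)) //= eqxx big1 ?addr0 // => j nj.
by case: eqP => // e; case/eqP: nj; apply: val_inj.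
Qed.

End UnshuffleSums.

(** * The symmetric algebra is spanned by products *)

Section Actions.
Variables (K : fieldType) (A : gcAlgebra K) (M : gMod A).

Lemma act_0l (x : M) : act 0 x = 0.
Proof.
have := act_linl x 1 (0 : A) 0; rewrite scaler0 addr0 scale1r => /eqP.
by rewrite -subr_eq0 opprD addrA subrr sub0r oppr_eq0 => /eqP.
Qed.

Lemma act_Zl c (a : A) (x : M) : act (c *: a) x = c *: act a x.
Proof. by rewrite -[c *: a]addr0 act_linl act_0l addr0. Qed.

Lemma act_Zr c (a : A) (x : M) : act a (c *: x) = c *: act a x.
Proof. by rewrite -[c *: x]addr0 act_linr act0r addr0. Qed.

Lemma act_Dr (a : A) (x y : M) : act a (x + y) = act a x + act a y.
Proof. by rewrite -[x]scale1r act_linr !scale1r. Qed.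

Lemma act_Nr (a : A) (x : M) : act a (- x) = - act a x.
Proof. by rewrite -scaleN1r act_Zr scaleN1r. Qed.

End Actions.

Section GradedLinear.
Variables (K : fieldType) (V : gradedModule K) (W : lmodType K).

Lemma glinear0 (f : V -> W) : glinear V f -> f 0 = 0.
Proof.
move=> lf; have := lf 0 1 0 0 (gm_comp0 V 0) (gm_comp0 V 0).
by rewrite scaler0 addr0 scale1r => /eqP;
  rewrite -subr_eq0 opprD addrA subrr sub0r oppr_eq0 => /eqP.
Qed.

Lemma glinearZ (f : V -> W) d c x : glinear V f -> gm_comp V d x -> f (c *: x) = c *: f x.
Proof.
by move=> lf hx; rewrite -[_ *: x]addr0 (lf d) ?glinear0 ?addr0 //; apply: gm_comp0.
Qed.

Lemma glinearD (f : V -> W) d x y :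
  glinear V f -> gm_comp V d x -> gm_comp V d y -> f (x + y) = f x + f y.
Proof. by move=> lf hx hy; rewrite -[x]scale1r (lf d) // !scale1r. Qed.

Lemma multilinear_glinear (F : seq V -> W) s t :
  multilinear V F -> homogl V s -> homogl V t -> glinear V (fun x => F (s ++ x :: t)).
Proof. by move=> lF hs ht d c x y hx hy; rewrite (lF d). Qed.

Lemma multilinear0 (F : seq V -> W) s t :
  multilinear V F -> homogl V s -> homogl V t -> F (s ++ 0 :: t) = 0.
Proof. by move=> lF hs ht; rewrite (glinear0 (multilinear_glinear lF hs ht)). Qed.

End GradedLinear.

Section SymmetricAlgebra.
Variables (K : fieldType) (A : gcAlgebra K) (L : gMod A) (S : symAlgebra L).
Local Notation sgn := (@sgn K).

(** Coefficients in [K] are enough for products of elements of [L], because a factor from [A] can be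
    absorbed into the first element of [L]. *)
Inductive sym_span (d : int) : S -> Prop :=
| sym_span0 : sym_span d 0
| sym_spanA c a u : gm_comp A d a -> sym_span d u -> sym_span d (c *: sa_A S a + u)
| sym_spanL c zs u : homogl L zs -> sdeg L zs = d -> sym_span d u ->
    sym_span d (c *: \prod_(z <- zs) sa_L S z + u).

Lemma sym_spanP d c u v : sym_span d u -> sym_span d v -> sym_span d (c *: u + v).
Proof.
move=> hu hv; elim: hu => [|e a w ha _ IH|e zs w hz dz _ IH].
- by rewrite scaler0 add0r.
- by rewrite scalerDr scalerA -addrA; apply: sym_spanA.
- by rewrite scalerDr scalerA -addrA; apply: sym_spanL.
Qed.

Lemma sym_spanZ d c u : sym_span d u -> sym_span d (c *: u).
Proof. by move=> hu; rewrite -[_ *: u]addr0; apply: sym_spanP => //;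
  apply: sym_span0. Qed.

Lemma sym_spanA1 d a : gm_comp A d a -> sym_span d (sa_A S a).
Proof.
by move=> ha; rewrite -[sa_A S a]scale1r -[_ *: _]addr0; apply: sym_spanA => //;
  apply: sym_span0.
Qed.

Lemma sym_spanL1 d zs : homogl L zs -> sdeg L zs = d ->
  sym_span d (\prod_(z <- zs) sa_L S z).
Proof.
by move=> hz dz; rewrite -[\prod_(z <- zs) _]scale1r -[_ *: _]addr0;
  apply: sym_spanL => //; apply: sym_span0.
Qed.

Lemma sa_A0 : sa_A S 0 = 0.
Proof. exact: (glinear0 (gh_lin (sa_A_hom S))). Qed.

Lemma sa_L0 : sa_L S 0 = 0.
Proof. exact: (glinear0 (mh_lin (sa_L_hom S))). Qed.

Lemma comp_sa_A d a : gm_comp A d a -> gm_comp S d (sa_A S a).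
Proof. exact: gh_deg (sa_A_hom S) d a. Qed.

Lemma comp_sa_L d x : gm_comp L d x -> gm_comp S d (sa_L S x).
Proof. exact: mh_deg (sa_L_hom S) d x. Qed.

Lemma comp_prod_L zs : homogl L zs -> gm_comp S (sdeg L zs) (\prod_(z <- zs) sa_L S z).
Proof.
elim: zs => [_|z zs IH /homogl_cons[hz /IH hzs]].
  by rewrite big_nil sdeg_nil; apply: ga_one.
by rewrite big_cons sdeg_cons; apply: ga_mul => //; apply/comp_sa_L/comp_deg.
Qed.

Lemma sym_span_comp d u : sym_span d u -> gm_comp S d u.
Proof.
elim=> [|c a w ha _ IH|c zs w hz <- _ IH]; first exact: gm_comp0.
  by apply: gm_compD => //; apply: comp_sa_A.
by apply: gm_compD => //; apply: comp_prod_L.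
Qed.

Lemma sym_span_L d x : gm_comp L d x -> sym_span d (sa_L S x).
Proof.
move=> hx; have [->|nx] := eqVneq x 0; first by rewrite sa_L0; apply: sym_span0.
have := @sym_spanL1 d [:: x]; rewrite big_seq1; apply.
  by apply/homogl_cons; split=> //; exists d.
by rewrite sdeg_cons sdeg_nil addr0; apply: (comp_uniq _ hx nx); apply: comp_deg;
  exists d.
Qed.

Lemma sa_A_prod a z zs : homog A a -> homog L z ->
  sa_A S a * \prod_(y <- z :: zs) sa_L S y = \prod_(y <- act a z :: zs) sa_L S y.
Proof. by move=> ha hz; rewrite !big_cons mulrA (mh_act (sa_L_hom S)). Qed.

Lemma sym_span_A_prod d a zs : gm_comp A d a -> homogl L zs ->
  sym_span (d + sdeg L zs) (sa_A S a * \prod_(z <- zs) sa_L S z).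
Proof.
move=> ha; case: zs => [_|z zs /homogl_cons[hz hzs]].
  by rewrite big_nil mulr1 sdeg_nil addr0; apply: sym_spanA1.
rewrite sa_A_prod //; last by exists d.
have haz := act_comp ha (comp_deg hz).
(* If [act a z] is 0, its degree is arbitrary and the degree condition of [sym_spanL1] may fail, but
   then the product is 0. *)
have [->|naz] := eqVneq (act a z) 0.
  by rewrite big_cons sa_L0 mul0r; apply: sym_span0.
apply: sym_spanL1; first by apply/homogl_cons; split=> //; exists (d + deg L z).
by rewrite !sdeg_cons addrA; congr (_ + _); apply: (comp_uniq _ haz naz);
  apply: comp_deg; exists (d + deg L z).
Qed.

Lemma sym_span_mul d e u v : sym_span d u -> sym_span e v -> sym_span (d + e) (u * v).
Proof.
move=> hu hv; elim: hu => [|c a w ha _ IH|c zs w hz dz _ IH].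
- by rewrite mul0r; apply: sym_span0.
- rewrite mulrDl -scalerAl; apply: sym_spanP => //.
  elim: hv => [|c' b w' hb _ IH'|c' zs w' hz <- _ IH'].
  + by rewrite mulr0; apply: sym_span0.
  + rewrite mulrDr -scalerAr; apply: sym_spanP => //.
    rewrite -(gh_mul (sa_A_hom S)); [|by exists d|by exists e].
    by apply/sym_spanA1/ga_mul.
  + by rewrite mulrDr -scalerAr; apply: sym_spanP => //; apply: sym_span_A_prod.
- rewrite mulrDl -scalerAl; apply: sym_spanP => //.
  have hp := comp_prod_L hz; rewrite dz in hp.
  elim: hv => [|c' b w' hb _ IH'|c' zs' w' hz' <- _ IH'].
  + by rewrite mulr0; apply: sym_span0.
  + rewrite mulrDr -scalerAr; apply: sym_spanP => //.
    (* The factor from [A] is moved to the front, where the first element of [L] absorbs it. *)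
    rewrite (ga_comm hp (comp_sa_A hb)) addrC -dz.
    by apply/sym_spanZ/sym_span_A_prod.
  + rewrite mulrDr -scalerAr; apply: sym_spanP => //.
    by rewrite -big_cat -dz -sdeg_cat; apply: sym_spanL1 => //; apply/homogl_cat.
Qed.

Lemma sym_span_one : sym_span 0 1.
Proof.
by rewrite -(gh_one (sa_A_hom S)); apply: sym_spanA1; apply: ga_one.
Qed.

Lemma sym_span_direct (s : seq int) (f : int -> S) : uniq s ->
  (forall d, sym_span d (f d)) -> \sum_(d <- s) f d = 0 ->
  forall d, d \in s -> f d = 0.
Proof. by move=> us hf; apply: ga_direct => // d; apply: sym_span_comp. Qed.

Lemma sym_span_comm d e u v : sym_span d u -> sym_span e v ->
  u * v = (sgn (d * e) : K) *: (v * u).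
Proof. by move=> /sym_span_comp hu /sym_span_comp hv; apply: ga_comm. Qed.

(* Same ring as S, but with smaller graded pieces: only inhomogeneous elements
   are added, so no subalgebra type is needed to use the universal property. *)
Definition spanAlg : gcAlgebra K :=
  @GcAlgebra K (ga_sort S) sym_span sym_span0 sym_spanP sym_span_direct
    sym_span_one sym_span_mul sym_span_comm.

(** The universal property gives a homomorphism h from [S] to [spanAlg] that fixes the generators.
    Read as an endomorphism of [S] it is the identity by uniqueness, so u = h u lies in the span. *)
Lemma comp_sym_span d u : gm_comp S d u -> sym_span d u.
Proof.
have hA : @gAlgHom K A spanAlg (sa_A S).
  case: (sa_A_hom S) => h1 h2 h3 h4; split=> // e a ha; exact: sym_spanA1.
have hL : @gModHom K A L spanAlg (sa_A S) (sa_L S).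
  case: (sa_L_hom S) => h1 h2 h3; split=> // e a ha; exact: sym_span_L.
have [h [[h1 h2 h3 h4] hA' hL']] := @sa_ex K A L S spanAlg _ _ hA hL.
move=> hu; have <- : h u = u; last exact: h2.
apply: (@sa_uniq _ _ _ S S h id) => //; last by exists d.
by split=> // e a ha; apply/sym_span_comp/h2.
Qed.

Lemma sym_ind (Q : S -> Prop) :
  (forall d c u v, gm_comp S d u -> gm_comp S d v -> Q u -> Q v -> Q (c *: u + v)) ->
  (forall a, homog A a -> Q (sa_A S a)) ->
  (forall x, homog L x -> Q (sa_L S x)) ->
  (forall u v, homog S u -> homog S v -> Q u -> Q v -> Q (u * v)) ->
  forall u, homog S u -> Q u.
Proof.
move=> Qlin QA QL Qmul u [d /comp_sym_span]; elim=> [|c a w ha hw IH|c zs w hz dz hw IH].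
- by rewrite -sa_A0; apply/QA/homog0.
- apply: (Qlin d) => //; [exact: comp_sa_A|exact: sym_span_comp|by apply: QA; exists d].
have hp := comp_prod_L hz; apply: (Qlin d) => //; [by rewrite -dz|exact: sym_span_comp|].
elim: zs hz {hp dz} => [_|z zs IHz /homogl_cons[hz hzs]].
  rewrite big_nil -(gh_one (sa_A_hom S)); apply: QA; exists 0; exact: ga_one.
rewrite big_cons; apply: Qmul; [|exists (sdeg L zs);
  exact: comp_prod_L|exact: QL|exact: IHz].
by exists (deg L z); apply/comp_sa_L/comp_deg.
Qed.

End SymmetricAlgebra.

(** * Insertions *)

Section FormLemmas.
Variables (K : fieldType) (A : gcAlgebra K) (L P : gMod A).
Local Notation sgn := (@sgn K).
Implicit Types (Om : Forms L P) (s : seq L).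

Lemma form_swap d Om : is_form d Om -> swap_symmetric (Om : seq L -> P).
Proof. by move=> hO; apply/gsymmetric_swap/(form_sym hO). Qed.

Lemma form0 d Om s t : is_form d Om -> homogl L s -> homogl L t -> Om (s ++ 0 :: t) = 0.
Proof. by move=> hO hs ht; apply: multilinear0 => //; apply: form_lin hO. Qed.

(** By symmetry every argument can be brought to the front, so K-linearity and A-linearity are
    checked in the first argument alone. *)
Lemma form_head d Om :
  (forall s, ~ homogl L s -> Om s = 0) ->
  (exists N, forall s, (N <= size s)%N -> Om s = 0) ->
  (forall s, homogl L s -> gm_comp P (d + sdeg L s) (Om s)) ->
  swap_symmetric (Om : seq L -> P) ->
  (forall e c x y s, homogl L s -> gm_comp L e x -> gm_comp L e y ->
     Om ((c *: x + y) :: s) = c *: Om (x :: s) + Om (y :: s)) ->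
  (forall a x s, homog A a -> homog L x -> homogl L s ->
     Om (act a x :: s) = sgn (deg A a * d) *: act a (Om (x :: s))) ->
  is_form d Om.
Proof.
move=> h1 h2 h3 symO lin alin; split=> //; first exact: swap_gsymmetric.
  move=> e s t c x y hs ht hx hy; have hz := gm_compD c hx hy.
  have hst : homogl L (s ++ t) by apply/homogl_cat.
  (* Vanishing at 0 follows from linearity with c = -1 and x = y = 0; it is what permits [deg_subst]
     below. *)
  have Om0 z : z = 0 -> Om (z :: s ++ t) = 0.
    move=> ->; have h0 := gm_comp0 L 0.
    by have := lin 0 (-1) 0 0 _ hst h0 h0; rewrite scaler0 addr0 scaleN1r addNr.
  rewrite !swap_front //; try (by exists e).
  rewrite (deg_subst (fun i => sgn (i * _)) hz (Om0 _)).
  rewrite (deg_subst (fun i => sgn (i * _)) hx (Om0 _)).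
  rewrite (deg_subst (fun i => sgn (i * _)) hy (Om0 _)).
  by rewrite (lin e) // scalerDr !scalerA mulrC.
move=> s t a x hs ht ha hx.
have hz := act_comp (comp_deg ha) (comp_deg hx).
have hst : homogl L (s ++ t) by apply/homogl_cat.
have Om0 z : z = 0 -> Om (z :: s ++ t) = 0.
  move=> ->; have h0 := gm_comp0 L 0.
  by have := lin 0 (-1) 0 0 _ hst h0 h0; rewrite scaler0 addr0 scaleN1r addNr.
rewrite !swap_front //; try (by exists (deg A a + deg L x)).
rewrite (deg_subst (fun i => sgn (i * _)) hz (Om0 _)) alin //.
by rewrite act_Zr !scalerA; congr (_ *: _); sign_tac.
Qed.

End FormLemmas.

Section Insertion.
Variables (K : fieldType) (A : gcAlgebra K) (L P : gMod A) (S : symAlgebra L).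
Variables (ins : S -> Forms L P -> Forms L P) (insP : insertion ins).
Local Notation sgn := (@sgn K).
Implicit Types (Om : Forms L P) (s : seq L).

Lemma ins_glinear d Om : is_form d Om -> glinear S (fun u => ins u Om).
Proof. by move=> hO; apply: (ins_lin insP); exists d. Qed.

Lemma ins_sa_A d a Om : homog A a -> is_form d Om ->
  ins (sa_A S a) Om = (fun s => act a (Om s)) :> (seq L -> P).
Proof. by move=> ha hO; rewrite (ins_A insP) //; exists d. Qed.

Lemma ins_prod d zs Om : homogl L zs -> is_form d Om ->
  ins (\prod_(z <- zs) sa_L S z) Om
  = (fun s => sgn (sdeg L zs * d) *: Om (zs ++ s)) :> (seq L -> P).
Proof.
move=> hz hO; rewrite (ins_L insP) //; last by exists d.
apply/funext => s; rewrite (@deg_subst _ (Forms L P) _ _ d Om (fun i => sgn (_ * i))) //.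
by move=> ->.
Qed.

Lemma ins_A_form d e a Om : gm_comp A e a -> is_form d Om ->
  is_form (d + e) (ins (sa_A S a) Om).
Proof.
move=> ha hO; rewrite (ins_sa_A _ hO); last by exists e.
have hO' := hO; case: hO => h1 [N h2] h3 h4 h5 h6.
apply: form_head => [s hs|||||].
- by rewrite h1 // act0r.
- by exists N => s hs; rewrite h2 // act0r.
- by move=> s hs; rewrite addrAC addrC; apply: act_comp => //; apply: h3.
- by move=> s x y t hs hx hy ht; rewrite (form_swap hO') // act_Zr.
- by move=> i c x y s hs hx hy; rewrite (h5 i [::]) // act_linr.
move=> b x s hb hx hs; rewrite (h6 [::]) // act_Zr -!act_mul.
rewrite (ga_comm ha (comp_deg hb)) act_Zl scalerA sdeg_nil.
by congr (_ *: _); sign_tac.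
Qed.

Lemma ins_prod_form d zs Om : homogl L zs -> is_form d Om ->
  is_form (d + sdeg L zs) (ins (\prod_(z <- zs) sa_L S z) Om).
Proof.
move=> hz hO; rewrite (ins_prod hz hO).
have hO' := hO; case: hO => h1 [N h2] h3 h4 h5 h6.
split => [s hs|||||].
- by rewrite h1 ?scaler0 // => /homogl_cat[].
- exists N => s hs; rewrite h2 ?scaler0 // size_cat.
  exact: leq_trans hs (leq_addl _ _).
- by move=> s hs; apply: compZ; rewrite -addrA -sdeg_cat; apply: h3; apply/homogl_cat.
- apply: swap_gsymmetric => s x y t hs hx hy ht.
  by rewrite !catA (form_swap hO') // ?scalerA 1?mulrC //; apply/homogl_cat.
- move=> i s t c x y hs ht hx hy; rewrite !catA (h5 i) //; last exact/homogl_cat.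
  by rewrite scalerDr !scalerA mulrC.
move=> s t a x hs ht ha hx; rewrite !catA h6 //; last exact/homogl_cat.
by rewrite act_Zr !scalerA sdeg_cat; congr (_ *: _); sign_tac.
Qed.

Lemma ins_form d e u Om : gm_comp S e u -> is_form d Om -> is_form (d + e) (ins u Om).
Proof.
move=> /comp_sym_span hu hO; have lin := ins_glinear hO.
elim: hu => [|c a w ha hw IH|c zs w hz <- hw IH].
- by rewrite (glinear0 lin); apply: form_comp0.
- rewrite (lin e) //; [|exact: comp_sa_A|exact: sym_span_comp].
  by apply: form_compD => //; apply: ins_A_form.
- move/sym_span_comp: hw => hw; rewrite (lin (sdeg L zs)) //; last exact: comp_prod_L.
  by apply: form_compD => //; apply: ins_prod_form.
Qed.

Lemma ins_linr u : homog S u -> glinear (Forms L P) (ins u).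
Proof.
move=> [e /comp_sym_span hu] d c Om Om' hO hO'; have hOO' := form_compD c hO hO'.
have [E1 E2 E3] := And3 (ins_glinear hO) (ins_glinear hO') (ins_glinear hOO').
elim: hu => [|b a w ha hw IH|b zs w hz dz hw IH].
- by rewrite (glinear0 E1) (glinear0 E2) (glinear0 E3) scaler0 addr0.
- have hw' := sym_span_comp hw; have ha' := comp_sa_A S ha.
  rewrite (E1 e) // (E2 e) // (E3 e) //.
  rewrite IH !(@ins_sa_A d) //; try by exists e.
  apply/funext => s /=.
  rewrite -[LHS]/(b *: act a (c *: Om s + Om' s) + (c *: ins w Om s + ins w Om' s)).
  rewrite -[RHS]/(c *: (b *: act a (Om s) + ins w Om s) + (b *: act a (Om' s) + ins w
    Om' s)).
  by rewrite act_linr !scalerDr !scalerA [c * b]mulrC addrACA.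
- have hp := comp_prod_L S hz; rewrite dz in hp; move/sym_span_comp in hw.
  rewrite (E1 e) // (E2 e) // (E3 e) // IH !(@ins_prod d) //.
  apply/funext => s /=; rewrite -[LHS]/(b *: (sgn (sdeg L zs * d) *:
    (c *: Om (zs ++ s) + Om' (zs ++ s))) + (c *: ins w Om s + ins w Om' s)).
  rewrite -[RHS]/(c *: (b *: (sgn (sdeg L zs * d) *: Om (zs ++ s)) + ins w Om s)
    + (b *: (sgn (sdeg L zs * d) *: Om' (zs ++ s)) + ins w Om' s)).
  rewrite !scalerDr !scalerA addrACA; congr (_ *: _ + _ + _); ring.
Qed.

Lemma ins_mul_linl e f d c u u' v Om :
  gm_comp S e u -> gm_comp S e u' -> gm_comp S f v -> is_form d Om ->
  ins (u * v) Om = ins u (ins v Om) -> ins (u' * v) Om = ins u' (ins v Om) ->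
  ins ((c *: u + u') * v) Om = ins (c *: u + u') (ins v Om).
Proof.
move=> hu hu' hv hO e1 e2; rewrite mulrDl -scalerAl.
rewrite (ins_glinear hO c (ga_mul hu hv) (ga_mul hu' hv)) e1 e2.
by rewrite (ins_glinear (ins_form hv hO) c hu hu').
Qed.

Lemma ins_mul_linr e f d c u v v' Om :
  gm_comp S e u -> gm_comp S f v -> gm_comp S f v' -> is_form d Om ->
  ins (u * v) Om = ins u (ins v Om) -> ins (u * v') Om = ins u (ins v' Om) ->
  ins (u * (c *: v + v')) Om = ins u (ins (c *: v + v') Om).
Proof.
move=> hu hv hv' hO e1 e2; rewrite mulrDr -scalerAr.
rewrite (ins_glinear hO c (ga_mul hu hv) (ga_mul hu hv')) e1 e2.
rewrite (ins_glinear hO c hv hv').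
by rewrite (ins_linr (homog_comp hu) _ (ins_form hv hO) (ins_form hv' hO)).
Qed.

Lemma ins_mul0l v d f Om : gm_comp S f v -> is_form d Om ->
  ins (0 * v) Om = ins 0 (ins v Om).
Proof.
by move=> hv hO; rewrite mul0r (glinear0 (ins_glinear hO)) (glinear0 (ins_glinear
  (ins_form hv hO))).
Qed.

Lemma ins_mul0r u d Om : homog S u -> is_form d Om -> ins (u * 0) Om = ins u (ins 0 Om).
Proof.
by move=> hu hO; rewrite mulr0 (glinear0 (ins_glinear hO)) (glinear0 (ins_linr hu)).
Qed.

(** The relation in [S] that absorbs a into the first factor is matched by the A-linearity of [Om]
    in its first argument. *)
Lemma ins_sa_A_prod d a zs Om : homog A a -> homogl L zs -> is_form d Om ->
  ins (sa_A S a * \prod_(z <- zs) sa_L S z) Om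
  = ins (sa_A S a) (ins (\prod_(z <- zs) sa_L S z) Om).
Proof.
move=> ha hz hO; have hp := ins_prod_form hz hO.
rewrite (ins_sa_A _ hp) // (ins_prod hz hO).
case: zs hz {hp} => [_|z zs /homogl_cons[hz hzs]].
  rewrite big_nil mulr1 (ins_sa_A _ hO) //; apply/funext=> s.
  by rewrite sdeg_nil mul0r sgn0 scale1r.
have haz := act_comp (comp_deg ha) (comp_deg hz).
rewrite sa_A_prod // (ins_prod _ hO); last first.
  by apply/homogl_cons; split=> //; exists (deg A a + deg L z).
have hO' := hO; case: hO => h1 _ h3 h4 h5 h6.
apply/funext => s; case: (pselect (homogl L s)) => hs; last first.
  by rewrite !h1 ?act0r ?scaler0 ?act0r // => /homogl_cat[].
have hzss : homogl L (zs ++ s) by apply/homogl_cat.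
rewrite !sdeg_cons (deg_subst (fun i => sgn ((i + _) * _)) haz); last first.
  by move=> e; rewrite e cat_cons -(cat0s (0 :: _)) (form0 hO').
rewrite act_Zr (h6 [::]) // !scalerA sdeg_nil.
by congr (_ *: _); sign_tac.
Qed.

(** By bilinearity u and v may be taken from the spanning set. The four cases rest on associativity
    of the action, A-linearity of forms, graded commutativity of [S], and graded symmetry of
    forms. *)
Lemma ins_mul d u v Om : homog S u -> homog S v -> is_form d Om ->
  ins (u * v) Om = ins u (ins v Om).
Proof.
move=> [e /comp_sym_span hu] [f /comp_sym_span hv] hO; have hv' := sym_span_comp hv.
elim: hu => [|c a w ha /sym_span_comp hw IH|c zs w hz dz /sym_span_comp hw IH].
- exact: ins_mul0l hv' hO.
- have ha' := comp_sa_A S ha; apply: (ins_mul_linl c ha' hw hv' hO) => // {c w hw IH hv'}.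
  elim: hv => [|c b w hb /sym_span_comp hw IH|c zs w hz dz /sym_span_comp hw IH].
  + by apply: ins_mul0r hO; exists e.
  + apply: (ins_mul_linr c ha' (comp_sa_A S hb) hw hO) => //.
    have hhb : homog A b by exists f.
    have hha : homog A a by exists e.
    rewrite -(gh_mul (sa_A_hom S)) // (ins_sa_A _ hO); last by exists (e + f);
      apply: ga_mul.
    rewrite (ins_sa_A hha (ins_A_form hb hO)) (ins_sa_A hhb hO).
    by apply/funext => s; rewrite act_mul.
  + have hp := comp_prod_L S hz; rewrite dz in hp.
    apply: (ins_mul_linr c ha' hp hw hO) => //.
    by apply: ins_sa_A_prod hO => //; exists e.
have hp := comp_prod_L S hz; rewrite dz in hp.
apply: (ins_mul_linl c hp hw hv' hO) => // {c w hw IH hv'}.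
elim: hv => [|c b w hb /sym_span_comp hw IH|c zs' w hz' dz' /sym_span_comp hw IH].
+ by apply: ins_mul0r hO; exists e.
+ have hb' := comp_sa_A S hb; apply: (ins_mul_linr c hp hb' hw hO) => //.
  have hhb : homog A b by exists f.
  have hO1 := ins_A_form hb hO.
  rewrite (ga_comm hp hb') (glinearZ _ (ins_glinear hO) (ga_mul hb' hp)).
  rewrite (ins_sa_A_prod hhb hz hO) (ins_sa_A hhb (ins_prod_form hz hO)).
  rewrite (ins_prod hz hO) (ins_prod hz hO1) (ins_sa_A hhb hO) dz.
  apply/funext => s; rewrite -[LHS]/(sgn (e * f) *: act b (sgn (e * d) *: Om (zs ++ s))).
  by rewrite act_Zr scalerA; congr (_ *: _); sign_tac.
have hp' := comp_prod_L S hz'; rewrite dz' in hp'.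
apply: (ins_mul_linr c hp hp' hw hO) => //.
have hO1 := ins_prod_form hz' hO; rewrite -big_cat /=.
rewrite (ins_prod _ hO); last exact/homogl_cat.
rewrite (ins_prod hz hO1) (ins_prod hz' hO) sdeg_cat dz dz'.
have h1 := form_norm hO; apply/funext => s.
case: (pselect (homogl L s)) => hs; last first.
  by rewrite !h1 ?scaler0 // => /homogl_cat[] // _ /homogl_cat[].
(* The composite evaluates [Om] on [zs' ++ zs ++ s]. The sign of exchanging the two blocks is
   supplied by the outer insertion, whose sign involves the degree of [ins v Om] instead of that of
   [Om]. *)
rewrite -catA (swap_blocks (form_swap hO) hz hz' hs) dz dz' !scalerA.
by congr (_ *: _); sign_tac.
Qed.

Lemma ins_comm d e f u v Om : gm_comp S e u -> gm_comp S f v -> is_form d Om ->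
  ins u (ins v Om) = sgn (e * f) *: ins v (ins u Om).
Proof.
move=> hu hv hO.
have [hhu hhv] : homog S u /\ homog S v by split; [exists e | exists f].
rewrite -!(ins_mul _ _ hO) // (ga_comm hu hv).
by rewrite (glinearZ _ (ins_glinear hO) (ga_mul hv hu)).
Qed.

End Insertion.

(** * The operators D_k on forms *)

Section Differential.
Variables (K : fieldType) (A : gcAlgebra K) (L P : gMod A).
Variables (X : seq L -> L) (symb : seq L -> A -> A) (LR : LRinfty X symb).
Variables (nabla : seq L -> P -> P) (conn : connection symb nabla).
Local Notation sgn := (@sgn K).
Implicit Types (Om : Forms L P) (s : seq L).

Let X_swap : swap_symmetric X := gsymmetric_swap (lr_sym LR).

Lemma X_lin s : homogl L s -> glinear L (fun x => X (x :: s)).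
Proof. by move=> hs; apply: (multilinear_glinear (lr_lin LR) (@homogl_nil _ L) hs). Qed.

Lemma nabla_lin s p : homogl L s -> homog P p -> glinear L (fun x => nabla (x :: s) p).
Proof.
by move=> hs hp; apply: (multilinear_glinear (conn_lin conn hp) (@homogl_nil _ L) hs).
Qed.

Lemma form_lin1 d Om s : is_form d Om -> homogl L s -> glinear L (fun x => Om (x :: s)).
Proof. by move=> hO hs; apply: (multilinear_glinear (form_lin hO) (@homogl_nil _ L)
  hs). Qed.

Lemma form_lin2 d Om y s : is_form d Om -> homog L y -> homogl L s ->
  glinear L (fun x => Om (y :: x :: s)).
Proof.
move=> hO hy hs; apply: (@multilinear_glinear _ _ _ _ [:: y] _ (form_lin hO)) => //.
exact/homogl_cons.
Qed.

Lemma form_homog d Om s : is_form d Om -> homogl L s -> homog P (Om s).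
Proof. by move=> hO hs; exists (d + sdeg L s); apply: form_deg. Qed.

Lemma nabla_comp s p e : homogl L s -> gm_comp P e p ->
  gm_comp P (1 + sdeg L s + e) (nabla s p).
Proof.
move=> hs hp; have [->|np] := eqVneq p 0.
  by rewrite (glinear0 (conn_klin conn hs)); apply: gm_comp0.
rewrite -(comp_uniq (comp_deg (homog_comp hp)) hp np).
by apply: (conn_deg conn) => //; exists e.
Qed.

Lemma symb_comp s a e : homogl L s -> gm_comp A e a ->
  gm_comp A (1 + sdeg L s + e) (symb s a).
Proof.
move=> hs ha; have [->|na] := eqVneq a 0.
  by rewrite (glinear0 (symb_klin LR hs)); apply: gm_comp0.
rewrite -(comp_uniq (comp_deg (homog_comp ha)) ha na).
by apply: (symb_deg LR) => //; exists e.
Qed.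

Lemma X_homog s : homogl L s -> homog L (X s).
Proof. by move=> hs; exists (1 + sdeg L s); apply: (lr_deg LR). Qed.

Lemma form_X_swap d Om b : is_form d Om -> homogl L b ->
  swap_symmetric (fun a => Om (X a :: b)).
Proof.
move=> hO hb s x y t hs hx hy ht; rewrite X_swap //.
apply: (glinearZ _ (form_lin1 hO hb) (lr_deg LR _)).
apply/homogl_cat; split=> //; apply/homogl_cons; split=> //; exact/homogl_cons.
Qed.

Lemma X_act_head a x s : homog A a -> homog L x -> homogl L s ->
  X (act a x :: s)
  = sgn ((deg A a + deg L x) * sdeg L s) *: act (symb s a) x
    + sgn (deg A a) *: act a (X (x :: s)).
Proof.
move=> ha hx hs; have hax := act_comp (comp_deg ha) (comp_deg hx).
have hn := @homogl_nil _ L.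
have := lr_leibniz LR hs ha hx.
rewrite -!cats1 !swap_front ?cats0 //; last by exists (deg A a + deg L x).
rewrite (deg_subst (fun i => sgn (i * _)) hax); last first.
  by move=> ->; apply: (glinear0 (X_lin hs)).
move/(congr1 (fun v => sgn ((deg A a + deg L x) * sdeg L s) *: v)).
rewrite scalerA sgnn scale1r => ->.
rewrite scalerDr act_Zr !scalerA; congr (_ + _ *: _).
by sign_tac.
Qed.

(** The summand of D_k at one splitting. The length of [a] tells which of the two kinds of
    unshuffles is meant, so a single sum over all splittings carries both. The degree [d] is a
    parameter because [deg] is arbitrary on the zero form. *)
Definition differential_kernel k d Om (a b : seq L) : P :=
  (if size a == k.-1 then sgn (d * sdeg L a) *: nabla a (Om b) else 0)
  - (if size a == k then sgn d *: Om (X a :: b) else 0).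

Local Notation Dker := differential_kernel.

Lemma DopE k d Om s : is_form d Om -> homogl L s ->
  Dop X nabla k Om s = usum s (Dker k d Om).
Proof.
move=> hO hs; rewrite /Dop asboolT //.
set e := deg _ _.
transitivity (usum s (fun a b => if size a == k.-1 then sgn (e * sdeg L a) *: nabla a
  (Om b) else 0)
   - usum s (fun a b => if size a == k then sgn e *: Om (X a :: b) else 0)).
  rewrite -!unshuffle_usum; congr (_ - _); apply: eq_bigr => pi _;
    by rewrite scalerA mulrC.
rewrite -scaleN1r addrC -usumP; apply: eq_usum => // a b [ha hb _ _].
rewrite scaleN1r addrC /differential_kernel; congr (_ - _); case: eqP => // _.
  rewrite (@deg_subst _ (Forms L P) _ _ d Om (fun i => sgn (i * _))) //.
  by move=> ->; apply: (glinear0 (conn_klin conn ha)).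
rewrite (@deg_subst _ (Forms L P) _ _ d Om (fun i => sgn i)) //.
by move=> ->.
Qed.

Section Kernel.
Variables (k : nat) (d : int) (Om : Forms L P) (hO : is_form d Om).

Lemma Dker_linl a b : homogl L a -> homogl L b ->
  glinear L (fun x => Dker k d Om (x :: a) b).
Proof.
move=> ha hb e c x y hx hy; rewrite /differential_kernel /=.
have hz := gm_compD c hx hy.
have ln := nabla_lin ha (form_homog hO hb); have lx := form_lin1 hO hb.
have lX := X_lin ha.
have comX z : gm_comp L e z -> gm_comp L (1 + sdeg L (z :: a)) (X (z :: a)).
  by move=> hez; apply: (lr_deg LR); apply/homogl_cons; split=> //; exists e.
have sub z : gm_comp L e z -> sgn (d * sdeg L (z :: a)) *: nabla (z :: a) (Om b)
    = sgn (d * (e + sdeg L a)) *: nabla (z :: a) (Om b).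
  move=> hez; rewrite sdeg_cons (deg_subst (fun i => sgn (_ * (i + _))) hez) //.
  by move=> ->; rewrite (glinear0 ln).
rewrite !sub // (ln e) // (lX e) //.
have hX z : gm_comp L e z -> homog L (X (z :: a)).
  by move=> hez; apply: X_homog; apply/homogl_cons; split=> //; exists e.
have -> : Om (c *: X (x :: a) + X (y :: a) :: b) = c *: Om (X (x :: a) :: b) + Om (X (y
  :: a) :: b).
  (* Additivity of [Om] needs a common degree for the two brackets, while [lr_deg] gives theirs in
     terms of [deg L x] and [deg L y], which equal e only for nonzero elements. *)
  have [x0|nx] := eqVneq x 0.
    by rewrite x0 (glinear0 lX) scaler0 add0r (glinear0 lx) scaler0 add0r.
  have [y0|ny] := eqVneq y 0.
    rewrite y0 (glinear0 lX) addr0 (glinear0 lx) addr0.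
    exact: (glinearZ _ lx (comX x hx)).
  apply: (lx (1 + (e + sdeg L a))).
    by rewrite -{1}(comp_uniq (comp_deg (homog_comp hx)) hx nx) -sdeg_cons; apply: comX.
  by rewrite -{1}(comp_uniq (comp_deg (homog_comp hy)) hy ny) -sdeg_cons; apply: comX.
case: eqP => _; case: eqP => _; rewrite ?scalerBr ?scalerDr ?scalerA ?scaler0 ?(subr0,
  sub0r, addr0) //.
- by rewrite [c * _]mulrC [in c * sgn d]mulrC opprD addrACA.
- by rewrite mulrC.
- by rewrite opprD mulrC.
Qed.

Lemma Dker_linr a b : homogl L a -> homogl L b ->
  glinear L (fun x => Dker k d Om a (x :: b)).
Proof.
move=> ha hb e c x y hx hy; rewrite /differential_kernel /=.
rewrite (form_lin1 hO hb c hx hy) (form_lin2 hO (X_homog ha) hb c hx hy).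
have dx z : gm_comp L e z -> z != 0 -> gm_comp P (d + (e + sdeg L b)) (Om (z :: b)).
  move=> hz nz; rewrite -{1}(comp_uniq (comp_deg (homog_comp hz)) hz nz) -sdeg_cons.
  by apply: (form_deg hO); apply/homogl_cons; split=> //; exists e.
have ln := conn_klin conn ha; have lx := form_lin1 hO hb.
have -> : nabla a (c *: Om (x :: b) + Om (y :: b)) = c *: nabla a (Om (x :: b)) + nabla
  a (Om (y :: b)).
  have [x0|nx] := eqVneq x 0.
    by rewrite x0 (glinear0 lx) scaler0 add0r (glinear0 ln) scaler0 add0r.
  have [y0|ny] := eqVneq y 0.
    by rewrite y0 (glinear0 lx) addr0 (glinear0 ln) addr0 (glinearZ _ ln (dx x hx nx)).
  by apply: (ln _ _ _ _ (dx x hx nx) (dx y hy ny)).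
case: eqP => _; case: eqP => _; rewrite ?scalerBr ?scalerDr ?scalerA ?scaler0 ?(subr0,
  sub0r, addr0) //.
- by rewrite [c * _]mulrC [in c * sgn d]mulrC opprD addrACA.
- by rewrite mulrC.
- by rewrite opprD mulrC.
Qed.

Lemma Dker_swapl b : homogl L b -> swap_symmetric ((Dker k d Om)^~ b).
Proof.
move=> hb s x y t hs hx hy ht; rewrite /differential_kernel.
rewrite (form_X_swap hO hb) // (gsymmetric_swap (conn_sym conn (form_homog hO hb))) //.
rewrite !size_cat /= !sdeg_cat !sdeg_cons [deg L y + (_ + _)]addrCA scalerBr.
by congr (_ - _); case: eqP => _; rewrite ?scaler0 // !scalerA mulrC.
Qed.

Lemma Dker_swapr a : homogl L a -> swap_symmetric (Dker k d Om a).
Proof.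
move=> ha s x y t hs hx hy ht; rewrite /differential_kernel.
have hh : homogl L (s ++ y :: x :: t).
  apply/homogl_cat; split=> //; apply/homogl_cons; split=> //; exact/homogl_cons.
rewrite (swap_symmetric_cons (X_homog ha) (form_swap hO)) // (form_swap hO) //.
rewrite (glinearZ _ (conn_klin conn ha) (form_deg hO hh)) scalerBr.
by congr (_ - _); case: eqP => _; rewrite ?scaler0 // !scalerA mulrC.
Qed.

End Kernel.
End Differential.

Lemma usum_map (K : fieldType) (V : gradedModule K) (W W' : lmodType K) (h : W -> W')
    (s : seq V) (f : seq V -> seq V -> W) :
  (forall c x y, h (c *: x + y) = c *: h x + h y) ->
  h (usum s f) = usum s (fun a b => h (f a b)).
Proof.
move=> hl; have hD x y : h (x + y) = h x + h y by rewrite -[x]scale1r hl !scale1r.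
have h0 : h 0 = 0 by apply: (addrI (h 0)); rewrite -hD !addr0.
have hZ c x : h (c *: x) = c *: h x by rewrite -[c *: x]addr0 hl h0 addr0.
elim: s f => [//|x s IH] f /=; rewrite hD !IH; congr (_ + _).
by apply: usum_ext => a b; rewrite hZ.
Qed.

Section DifferentialForm.
Variables (K : fieldType) (A : gcAlgebra K) (L P : gMod A).
Variables (X : seq L -> L) (symb : seq L -> A -> A) (LR : LRinfty X symb).
Variables (nabla : seq L -> P -> P) (conn : connection symb nabla).
Local Notation sgn := (@sgn K).
Local Notation Dker := (differential_kernel X nabla).
Implicit Types (Om : Forms L P) (s : seq L).

Lemma form_act_head d Om a x b : is_form d Om -> homog A a -> homog L x -> homogl L b ->
  Om (act a x :: b) = sgn (deg A a * d) *: act a (Om (x :: b)).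
Proof.
by move=> hO ha hx hb; rewrite (form_alin hO (s1 := [::])) // sdeg_nil addr0.
Qed.

Lemma form_act_second d e Om y a x b : is_form d Om ->
  gm_comp L e y -> homog A a -> homog L x -> homogl L b ->
  Om (y :: act a x :: b) = sgn (deg A a * (d + e)) *: act a (Om (y :: x :: b)).
Proof.
move=> hO hy ha hx hb; rewrite (form_alin hO (s1 := [:: y])) //; last first.
  by apply/homogl_cons; split=> //; exists e.
rewrite sdeg_cons sdeg_nil addr0 (deg_subst (fun i => sgn (_ * (_ + i))) hy) //.
have hxb : homogl L (x :: b) by apply/homogl_cons.
by move=> ->; rewrite (glinear0 (form_lin1 hO hxb)) act0r.
Qed.

(** Neither term on the left is A-linear in xi. The two splittings that differ only in the side of
    the head are added because their symbol terms cancel. *)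
Lemma Dker_act k d Om al xi a b : is_form d Om ->
  homog A al -> homog L xi -> homogl L a -> homogl L b ->
  Dker k.+1 d Om (act al xi :: a) b
    + sgn ((deg A al + deg L xi) * sdeg L a) *: Dker k.+1 d Om a (act al xi :: b)
  = sgn (deg A al * (d + 1)) *: act al
     (Dker k.+1 d Om (xi :: a) b + sgn (deg L xi * sdeg L a) *: Dker k.+1 d Om a (xi ::
       b)).
Proof.
move=> hO hal hxi ha hb; rewrite /differential_kernel /=.
have hax := act_comp (comp_deg hal) (comp_deg hxi).
have hb' : homogl L (xi :: b) by apply/homogl_cons.
have ha' : homogl L (xi :: a) by apply/homogl_cons.
have hXa' := lr_deg LR ha'.
set N := nabla (act al xi :: a) (Om b).
have -> : sgn (d * sdeg L (act al xi :: a)) *: N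
    = sgn (d * (deg A al + deg L xi + sdeg L a)) *: N.
  rewrite sdeg_cons (deg_subst (fun i => sgn (_ * (i + _))) hax) // => e.
  by rewrite /N e; apply: (glinear0 (nabla_lin conn ha (form_homog hO hb))).
have -> : N = sgn (deg A al) *: act al (nabla (xi :: a) (Om b)).
  rewrite /N (conn_alin conn (form_homog hO hb) (s1 := [::])) //.
  by rewrite sdeg_nil addr0 mulr1.
have hs := symb_comp LR ha (comp_deg hal).
have hsx := act_comp hs (comp_deg hxi).
have -> : Om (X (act al xi :: a) :: b) =
  sgn ((deg A al + deg L xi) * sdeg L a + (1 + sdeg L a + deg A al) * d)
    *: act (symb a al) (Om (xi :: b))
  + sgn (deg A al * (d + 1)) *: act al (Om (X (xi :: a) :: b)).
  rewrite (X_act_head LR) //.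
  rewrite (form_lin1 hO hb _ hsx); last first.
    rewrite (_ : _ + deg L xi = deg A al + (1 + sdeg L (xi :: a))); last first.
      by rewrite sdeg_cons; ring.
    by apply/compZ/act_comp => //; apply: comp_deg.
  have hal' := act_comp (comp_deg hal) hXa'.
  rewrite (glinearZ _ (form_lin1 hO hb) hal').
  rewrite !(form_act_head hO) //; try by [exists (1 + sdeg L (xi :: a))|exists (1 +
    sdeg L a + deg A al)].
  rewrite (deg_subst (fun i => sgn (i * _)) hs); last by move=> ->; rewrite act_0l.
  by rewrite !scalerA; congr (_ *: _ + _ *: _); sign_tac.
have hp := form_deg hO hb'.
rewrite (form_act_head hO) // (form_act_second hO (lr_deg LR ha)) //.
rewrite (glinearZ _ (conn_klin conn ha) (act_comp (comp_deg hal) hp)).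
rewrite (conn_leibniz conn ha hal (form_homog hO hb')).
rewrite !sdeg_cons eqSS.
(* Symbols occur only for [size a = k], where the connection takes [a] and [X] takes
   [act al xi :: a]; [aux] cancels them. *)
have [e1|n1] := eqVneq (size a) k.
  rewrite e1 (gtn_eqF (ltnSn k)) (ltn_eqF (ltnSn k)).
  rewrite !sub0r !subr0 !act_Dr !act_Nr !act_Zr !scalerDr !scalerN !scalerA.
  have aux (W : lmodType K) (u v w : W) p1 p2 q1 q2 r1 r2 : p1 = q2 -> p2 = r2 ->
    q1 = r1 ->
      - (p1 *: u + p2 *: v) + (q1 *: w + q2 *: u) = - (r2 *: v) + r1 *: w.
    move=> -> -> ->; rewrite opprD [r1 *: w + _]addrC addrACA addNr add0r //.
  by apply: aux; sign_tac.
have [e2|n2] := eqVneq (size a).+1 k; have [e3|n3] := eqVneq (size a) k.+1;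
  rewrite ?(subr0, sub0r, oppr0, scaler0, add0r, addr0, act0r) //
    ?act_Dr ?scalerDr ?scalerN ?act_Nr ?act_Zr ?scalerN ?scalerA.
all: try (congr (_ *: _ + - (_ *: _)); sign_tac).
all: try (congr (- (_ *: _)); sign_tac).
all: try (congr (_ *: _); sign_tac).
Qed.

Lemma DopC k d Om s : is_form d Om -> ~ homogl L s -> Dop X nabla k Om s = 0.
Proof. by move=> _ ns; rewrite /Dop asboolF. Qed.

Lemma Dop_form k d Om : is_form d Om -> is_form (d + 1) (Dop X nabla k.+1 Om).
Proof.
move=> hO; apply: form_head => [s||s hs|||].
- exact: DopC hO.
(* In both terms [Om] is evaluated on [size s - k] arguments. *)
- have [N hN] := form_fin hO; exists (N + k.+1)%N => s sN.
  case: (pselect (homogl L s)) => hs; last exact: DopC hO hs.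
  rewrite (DopE X conn _ hO hs) -[RHS](usum0 P s); apply: eq_usum => // a b [ha hb ab _].
  rewrite /differential_kernel /=; case: eqP => [ak|_]; case: eqP => [ak'|_];
    rewrite ?subr0 //.
  + by move: ak' (ltnSn k); rewrite ak => {1}->; rewrite ltnn.
  + rewrite hN ?(glinear0 (conn_klin conn ha)) ?scaler0 //.
    by rewrite -(leq_add2r (size a)) [(size b + _)%N]addnC ab ak (leq_trans _ sN) //
      leq_add2l.
  + rewrite hN ?scaler0 ?subr0 //= -(leq_add2r (size a)) addSn [(size b + _)%N]addnC ab
    ak'.
    exact: leqW.
- rewrite (DopE X conn _ hO hs); apply: usum_closed => // [c x y|a b [ha hb ab <-]].
    exact: gm_compD.
  apply: compD; [case: eqP => _ | apply: compN; case: eqP => _]; try exact: gm_comp0.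
    apply: compZ; have := nabla_comp conn ha (form_deg hO hb).
    by congr gm_comp; ring.
  apply: compZ; have hX := lr_deg LR ha.
  have [->|nX] := eqVneq (X a) 0.
    by rewrite (glinear0 (form_lin1 hO hb)); apply: gm_comp0.
  have := form_deg hO (s := X a :: b).
  rewrite sdeg_cons (comp_uniq (comp_deg (homog_comp hX)) hX nX).
  by rewrite !addrA; apply; apply/homogl_cons; split=> //; exists (1 + sdeg L a).
- move=> s x y t hs hx hy ht.
  rewrite !(DopE X conn _ hO); try by apply/homogl_cat; split=> //; apply/homogl_cons;
    split=> //; apply/homogl_cons.
  apply: (usum_swap (f := Dker k.+1 d Om)) => // [b hb|a ha].
    exact (Dker_swapl LR conn k.+1 hO hb).
  exact (Dker_swapr LR conn k.+1 hO ha).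
- move=> e c x y s hs hx hy; have hz := gm_compD c hx hy.
  rewrite !(DopE X conn _ hO); try by apply/homogl_cons; split=> //; exists e.
  rewrite /= scalerDr addrACA -!usumP; congr (_ + _).
    apply: eq_usum => // a b [ha hb _ _].
    exact: (Dker_linl LR conn _ hO ha hb c hx hy).
  apply: eq_usum => // a b [ha hb _ _].
  have lin := Dker_linr LR conn k.+1 hO ha hb.
  have vanish z : z = 0 -> Dker k.+1 d Om a (z :: b) = 0.
    by move=> ->; apply: (glinear0 lin).
  rewrite (deg_subst (fun i => sgn (i * _)) hz (vanish _)).
  rewrite (deg_subst (fun i => sgn (i * _)) hx (vanish _)).
  rewrite (deg_subst (fun i => sgn (i * _)) hy (vanish _)).
  by rewrite (lin _ c _ _ hx hy) scalerDr !scalerA mulrC.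
move=> al xi s hal hxi hs.
have hax := act_comp (comp_deg hal) (comp_deg hxi).
rewrite !(DopE X conn _ hO); try by apply/homogl_cons; split=> //;
  exists (deg A al + deg L xi).
rewrite /= -!usumD -[LHS]/(usum _ _) (@usum_map _ _ _ _ (act al)); last first.
  by move=> c x y; rewrite act_linr.
rewrite -usumZ; apply: eq_usum => // a b [ha hb _ _].
rewrite -(Dker_act _ hO hal hxi ha hb); congr (_ + _).
rewrite (deg_subst (fun i => sgn (i * _)) hax) // => ->.
exact: (glinear0 (Dker_linr LR conn _ hO ha hb)).
Qed.

Lemma Dop_glinear k : glinear (Forms L P) (Dop X nabla k).
Proof.
move=> d c Om Om' hO hO'; apply/funext => s.
rewrite -[RHS]/(c *: Dop X nabla k Om s + Dop X nabla k Om' s).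
have hOO' := form_compD c hO hO'.
case: (pselect (homogl L s)) => hs; last first.
  by rewrite (DopC _ hO hs) (DopC _ hO' hs) (DopC _ hOO' hs) scaler0 addr0.
rewrite (DopE X conn k hO hs) (DopE X conn k hO' hs) (DopE X conn k hOO' hs) -usumP.
apply: eq_usum => // a b [ha hb _ _]; rewrite /differential_kernel.
rewrite -[(_ + _) b]/(c *: Om b + Om' b).
rewrite -[(_ + _) (X a :: b)]/(c *: Om (X a :: b) + Om' (X a :: b)).
rewrite (conn_klin conn ha c (form_deg hO hb) (form_deg hO' hb)).
case: eqP => _; case: eqP => _; rewrite ?scalerBr ?scalerDr ?scalerA ?scaler0 ?(subr0,
  sub0r, addr0) //.
- by rewrite [c * _]mulrC [in c * sgn d]mulrC opprD addrACA.
- by rewrite mulrC.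
- by rewrite opprD mulrC.
Qed.

End DifferentialForm.

(** * Iterated commutators with insertions *)

Section Operators.
Variables (K : fieldType) (A : gcAlgebra K) (L P : gMod A) (S : symAlgebra L).
Variables (ins : S -> Forms L P -> Forms L P) (insP : insertion ins).
Local Notation sgn := (@sgn K).
Local Notation op := (Forms L P -> Forms L P).
Implicit Types (Om : Forms L P) (F G : op) (u v : S) (us vs : seq S).

Definition is_op (e : int) F : Prop :=
  (forall d Om, is_form d Om -> is_form (d + e) (F Om)) /\ glinear (Forms L P) F.

(* Operators only matter through their values on homogeneous forms. *)
Definition eq_op F G : Prop := forall d Om, is_form d Om -> F Om = G Om.

Lemma is_op_form e F d Om : is_op e F -> is_form d Om -> is_form (d + e) (F Om).
Proof. by case=> h _; apply: h. Qed.

Lemma is_op0 e F : is_op e F -> F 0 = 0.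
Proof. by case=> _; apply: glinear0. Qed.

Lemma is_opZ e F d c Om : is_op e F -> is_form d Om -> F (c *: Om) = c *: F Om.
Proof. by case=> _ lF hO; apply: (glinearZ _ lF hO). Qed.

Lemma is_opP e F d c Om Om' : is_op e F -> is_form d Om -> is_form d Om' ->
  F (c *: Om + Om') = c *: F Om + F Om'.
Proof. by case=> _ lF hO hO'; apply: (lF d). Qed.

Lemma is_opB e F d c Om Om' : is_op e F -> is_form d Om -> is_form d Om' ->
  F (Om - c *: Om') = F Om - c *: F Om'.
Proof.
by move=> hF hO hO'; rewrite -scaleNr addrC (is_opP _ hF hO' hO) scaleNr addrC.
Qed.

Lemma ins_op e u : gm_comp S e u -> is_op e (ins u).
Proof.
move=> hu; split; first by move=> d Om; apply: (ins_form insP).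
exact: (ins_linr insP (homog_comp hu)).
Qed.

Lemma is_op_lin e c F G : is_op e F -> is_op e G -> is_op e (fun Om => c *: F Om + G Om).
Proof.
move=> hF hG; split=> [d Om hO|d b Om Om' hO hO'].
  by apply: form_compD; [apply: is_op_form hF hO | apply: is_op_form hG hO].
rewrite (is_opP _ hF hO hO') (is_opP _ hG hO hO') !scalerDr !scalerA [c * b]mulrC.
by rewrite addrACA.
Qed.

Lemma is_op_comp e f F G : is_op e F -> is_op f G -> is_op (e + f) (fun Om => F (G Om)).
Proof.
move=> hF hG; split=> [d Om hO|d b Om Om' hO hO'].
  by rewrite addrA addrAC; apply: is_op_form hF _; apply: is_op_form hG hO.
by rewrite (is_opP _ hG hO hO') (is_opP _ hF (is_op_form hG hO) (is_op_form hG hO')).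
Qed.

Lemma gcomm_op e f F G : is_op e F -> is_op f G -> is_op (e + f) (gcomm e f F G).
Proof.
move=> hF hG; have := is_op_lin (- sgn (e * f)) (is_op_comp hG hF).
rewrite addrC => /(_ _ (is_op_comp hF hG)).
by congr is_op; apply/funext => Om; rewrite addrC scaleNr.
Qed.

Lemma icomm_op e F us : is_op e F -> homogl S us ->
  is_op (e + sdeg S us) (icomm S ins e F us).
Proof.
elim: us e F => [|u us IH] e F hF; first by rewrite sdeg_nil addr0.
move=> /homogl_cons[hu hus]; rewrite sdeg_cons addrA /=.
by apply: IH => //; apply: gcomm_op => //; apply: ins_op; apply: comp_deg.
Qed.

Lemma gcomm_eq e f F G H : is_op f H -> eq_op F G ->
  eq_op (gcomm e f F H) (gcomm e f G H).
Proof.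
by move=> hH FG d Om hO; rewrite /gcomm (FG _ _ hO) (FG _ _ (is_op_form hH hO)).
Qed.

Lemma icomm_eq e F G us : homogl S us -> eq_op F G ->
  eq_op (icomm S ins e F us) (icomm S ins e G us).
Proof.
elim: us e F G => [//|u us IH] e F G /homogl_cons[hu hus] FG /=.
by apply: IH => //; apply: gcomm_eq FG; apply: ins_op; apply: comp_deg.
Qed.

Lemma icomm_lin e c F G us d Om : homogl S us -> is_op e F -> is_op e G -> is_form d Om ->
  icomm S ins e (fun Om => c *: F Om + G Om) us Om
  = c *: icomm S ins e F us Om + icomm S ins e G us Om.
Proof.
elim: us e F G => [//|u us IH] e F G /homogl_cons[hu hus] hF hG hO /=.
have hi := ins_op (comp_deg hu).
rewrite -IH //; try exact: gcomm_op.
apply: (icomm_eq _ hus _ hO) => d' Om' hO'; rewrite /gcomm.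
rewrite (is_opP _ hi (is_op_form hF hO') (is_op_form hG hO')).
by rewrite scalerBr scalerDr !scalerA [c * sgn _]mulrC opprD addrACA.
Qed.

Lemma icomm_0 e F us d Om : homogl S us -> is_op e F -> eq_op F (fun=> 0) ->
  is_form d Om ->
  icomm S ins e F us Om = 0.
Proof.
move=> hus hF F0 hO.
(* Where [F] is 0 it agrees with - F + F, and there linearity makes the iterated commutator cancel
   itself. *)
rewrite (icomm_eq e hus (G := fun Om => -1 *: F Om + F Om) _ hO).
  by rewrite (icomm_lin _ hus hF hF hO) scaleN1r addNr.
by move=> d' Om' hO'; rewrite (F0 _ _ hO') scaler0 addr0.
Qed.

Lemma icommZ e c F us d Om : homogl S us -> is_op e F -> is_form d Om ->
  icomm S ins e (fun Om => c *: F Om) us Om = c *: icomm S ins e F us Om.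
Proof.
move=> hus hF hO; have h0 : is_op e (fun=> 0 : Forms L P).
  split=> [i Om' _|i b Om1 Om2 _ _]; first exact: form_comp0.
  by rewrite scaler0 addr0.
rewrite -[RHS]addr0 -(icomm_0 hus h0 _ hO) // -(icomm_lin _ hus hF h0 hO).
by apply: (icomm_eq _ hus _ hO) => i Om' _; rewrite addr0.
Qed.

Lemma icomm_sum (I : Type) (r : seq I) e (F : I -> op) us d Om :
  homogl S us -> (forall i, is_op e (F i)) -> is_form d Om ->
  icomm S ins e (fun Om => \sum_(i <- r) F i Om) us Om = \sum_(i <- r) icomm S ins e (F
    i) us Om.
Proof.
move=> hus hF hO.
have op_sum s : is_op e (fun Om => \sum_(i <- s) F i Om).
  elim: s => [|i s IH].
    split=> [j Om' _|j b Om1 Om2 _ _]; rewrite !big_nil; first exact: form_comp0.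
    by rewrite scaler0 addr0.
  have := is_op_lin 1 (hF i) IH; congr is_op.
  by apply/funext => Om'; rewrite big_cons scale1r.
elim: r => [|i r IH].
  rewrite big_nil; apply: (icomm_0 hus _ _ hO).
    by have := op_sum [::].
  by move=> *; rewrite big_nil.
rewrite big_cons -IH -[icomm S ins e (F i) us Om]scale1r -(icomm_lin _ hus (hF i)
  (op_sum r) hO).
by apply: (icomm_eq _ hus _ hO) => j Om' _; rewrite big_cons scale1r.
Qed.

Lemma icomm_cat e F us vs :
  icomm S ins e F (us ++ vs) = icomm S ins (e + sdeg S us) (icomm S ins e F us) vs.
Proof.
elim: us e F => [|u us IH] e F; first by rewrite sdeg_nil addr0.
by rewrite /= IH sdeg_cons addrA.
Qed.

(** Lets any degree f of u replace [deg S u]: for u = 0, where they may differ, both sides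
    vanish. *)
Lemma icomm_cons e F f u us d Om : is_op e F -> gm_comp S f u -> homogl S us ->
  is_form d Om ->
  icomm S ins e F (u :: us) Om = icomm S ins (e + f) (gcomm e f F (ins u)) us Om.
Proof.
move=> hF hu hus hO; have [u0|nu] := eqVneq u 0; last first.
  by rewrite /= (comp_uniq (comp_deg (homog_comp hu)) hu nu).
have zero i : eq_op (gcomm e i F (ins u)) (fun=> 0).
  move=> d' Om' hO'; rewrite /gcomm u0 (glinear0 (ins_glinear insP hO')) (is_op0 hF).
  by rewrite (glinear0 (ins_glinear insP (is_op_form hF hO'))) scaler0 subr0.
have opc i : gm_comp S i u -> is_op (e + i) (gcomm e i F (ins u)).
  by move=> hi; apply: gcomm_op => //; apply: ins_op.
rewrite /= (icomm_0 hus (opc _ _) (zero _) hO); last exact: comp_deg (homog_comp hu).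
by rewrite (icomm_0 hus (opc _ _) (zero _) hO).
Qed.

(** The graded Jacobi identity: the two orders of bracketing differ by [F, [i_u, i_v]], and
    insertions commute. *)
Lemma icomm_swap e F d Om : is_op e F -> is_form d Om ->
  @swap_symmetric K S (Forms L P) (fun us => icomm S ins e F us Om).
Proof.
move=> hF hO s u v t hs hu hv ht; rewrite !icomm_cat.
have := icomm_op hF hs; move: (e + _) (icomm _ _ _ _ _) => {hF e F} e F hF /=.
set f := deg S u; set g := deg S v.
have hf : gm_comp S f u := comp_deg hu; have hg : gm_comp S g v := comp_deg hv.
have [iu iv] := (ins_op hf, ins_op hg).
rewrite -[e + g + f]addrAC -(icommZ _ ht _ hO); last first.
  by rewrite addrAC; apply: gcomm_op => //; apply: gcomm_op.
apply: (icomm_eq _ ht _ hO) => {hO} {}d {}Om hO; rewrite /gcomm.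
have [hu1 hv1] := (is_op_form iu hO, is_op_form iv hO).
have hFO := is_op_form hF hO.
have hFu : is_form (d + e + f) (F (ins u Om)) by rewrite addrAC; apply: is_op_form hF hu1.
have hFv : is_form (d + e + g) (F (ins v Om)) by rewrite addrAC; apply: is_op_form hF hv1.
rewrite (is_opB _ iv hFu (is_op_form iu hFO)).
rewrite (is_opB _ iu hFv (is_op_form iv hFO)).
rewrite (ins_comm insP hf hg hO) (ins_comm insP hf hg hFO).
rewrite (is_opZ _ hF (is_op_form iv hu1)) !scalerBr !scalerA.
have aux (W : lmodType K) (t1 t2 t3 t4 : W) a b c x b' c' x' : b = b' -> c = c' ->
  x = x' ->
    a *: t1 - b *: t2 - (c *: t3 - x *: t4) = a *: t1 - c' *: t3 - (b' *: t2 - x' *: t4).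
  by move=> -> -> ->; rewrite !opprB addrACA [RHS]addrACA; congr (_ + _); rewrite addrC.
by apply: aux; sign_tac.
Qed.

Lemma icomm_glinear e F us d Om : is_op e F -> homogl S us -> is_form d Om ->
  glinear S (fun u => icomm S ins e F (u :: us) Om).
Proof.
move=> hF hus hO f c u v hu hv; have huv := gm_compD c hu hv.
rewrite !(icomm_cons hF _ hus hO (f := f)) //.
have hG w : gm_comp S f w -> is_op (e + f) (gcomm e f F (ins w)).
  by move=> hw; apply: gcomm_op => //; apply: ins_op.
rewrite -(icomm_lin c hus (hG u hu) (hG v hv) hO).
apply: (icomm_eq _ hus _ hO) => {hO} {}d {}Om hO; rewrite /gcomm.
have hFO := is_op_form hF hO.
rewrite (ins_glinear insP hO c hu hv) (ins_glinear insP hFO c hu hv).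
rewrite (is_opP _ hF (ins_form insP hu hO) (ins_form insP hv hO)).
by rewrite scalerBr scalerDr !scalerA [c * sgn _]mulrC opprD addrACA.
Qed.

(** Bracketing with i_u is a derivation of composition, so each u goes either to [F] or to [G]. This
    choice is the recursion of [usum], up to the sign for moving u past [G]. *)
Lemma icomm_compose e f F G us d Om :
  is_op e F -> is_op f G -> homogl S us -> is_form d Om ->
  icomm S ins (e + f) (fun Om => F (G Om)) us Om
  = @usum K S (Forms L P) us (fun a b =>
      sgn (f * sdeg S a) *: icomm S ins e F a (icomm S ins f G b Om)).
Proof.
elim: us e f F G => [|u us IH] e f F G hF hG.
  by rewrite /= sdeg_nil mulr0 sgn0 scale1r.
move=> /homogl_cons[hu hus] hO /=; set i := deg S u.
have hi : is_op i (ins u) by apply/ins_op/comp_deg.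
have hFu := gcomm_op hF hi; have hGu := gcomm_op hG hi.
have hl := is_op_comp hFu hG; have hr := is_op_comp hF hGu.
rewrite addrAC in hl; rewrite addrA in hr.
transitivity (icomm S ins (e + f + i) (fun Om => sgn (f * i) *: gcomm e i F (ins u) (G Om)
    + F (gcomm f i G (ins u) Om)) us Om).
  apply: (icomm_eq _ hus _ hO) => {IH hO} {}d {}Om hO; rewrite /gcomm.
  have h1 : is_form (d + f + i) (G (ins u Om)).
    by rewrite addrAC; apply: is_op_form hG _; apply: is_op_form hi hO.
  rewrite (is_opB _ hF h1 (is_op_form hi (is_op_form hG hO))) scalerBr !scalerA.
  by rewrite [RHS]addrC addrA addrNK; congr (_ - _ *: _); sign_tac.
rewrite (icomm_lin _ hus hl hr hO); congr (_ + _).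
  rewrite addrAC (IH _ _ _ _ hFu hG hus hO) -usumZ; apply: usum_ext => a b.
  by rewrite scalerA sdeg_cons -/i; congr (_ *: _); sign_tac.
rewrite -addrA (IH _ _ _ _ hF hGu hus hO); apply: usum_ext => a b.
by rewrite scalerA; congr (_ *: _); sign_tac.
Qed.

Lemma icomm_ins_0 e c u us d Om : gm_comp S e u -> homogl S us -> us <> [::] ->
  is_form d Om ->
  icomm S ins e (fun Om => c *: ins u Om) us Om = 0.
Proof.
case: us => [//|v us] hu /homogl_cons[hv hus] _ hO.
have hi := ins_op hu; have hj := ins_op (comp_deg hv).
rewrite (icommZ _ _ hi hO); last exact/homogl_cons.
rewrite /= (icomm_0 hus (gcomm_op hi hj) _ hO) ?scaler0 // => {hO} {}d {}Om hO.
rewrite /gcomm (ins_comm insP hu (comp_deg hv) hO); set w := ins _ _.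
by rewrite subrr.
Qed.

(** As i_(uv) is the composite of i_u and i_v, the first commutator satisfies the Leibniz rule. In
    the later ones the outer factors i_u and i_v commute with all insertions, so by [icomm_compose]
    all of [us] must go to the other factor. *)
Lemma icomm_mul e F u v us d Om : is_op e F -> homog S u -> homog S v -> homogl S us ->
  is_form d Om ->
  icomm S ins e F (u * v :: us) Om
  = sgn (e * deg S u) *: ins u (icomm S ins e F (v :: us) Om)
    + sgn (deg S v * sdeg S us) *: icomm S ins e F (u :: us) (ins v Om).
Proof.
move=> hF hu hv hus hO; set i := deg S u; set j := deg S v.
have cu : gm_comp S i u := comp_deg hu; have cv : gm_comp S j v := comp_deg hv.
have [iu iv] := (ins_op cu, ins_op cv).
rewrite (icomm_cons hF (ga_mul cu cv) hus hO).
have hFu := gcomm_op hF iu; have hFv := gcomm_op hF iv.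
have hl := is_op_comp iu hFv; have hr := is_op_comp hFu iv.
have E : i + (e + j) = e + (i + j) by ring.
rewrite E in hl; rewrite -addrA in hr.
transitivity (icomm S ins (e + (i + j)) (fun Om => sgn (e * i) *: ins u (gcomm e j F
  (ins v) Om)
    + gcomm e i F (ins u) (ins v Om)) us Om).
  apply: (icomm_eq _ hus _ hO) => {hO} {}d {}Om hO; rewrite /gcomm.
  have hFO := is_op_form hF hO.
  rewrite (ins_mul insP hu hv hO) (ins_mul insP hu hv hFO).
  have h1 : is_form (d + e + j) (F (ins v Om)).
    by rewrite addrAC; apply: is_op_form hF _; apply: is_op_form iv hO.
  rewrite (is_opB _ iu h1 (is_op_form iv hFO)) scalerBr !scalerA.
  by rewrite [RHS]addrC addrA addrNK; congr (_ - _ *: _); sign_tac.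
rewrite (icomm_lin _ hus hl hr hO); congr (_ *: _ + _).
  rewrite -E (icomm_compose iu hFv hus hO) usum_nill //.
    by rewrite /= sdeg_nil mulr0 sgn0 scale1r.
  move=> a b [ha hb _ _] na.
  have := icomm_ins_0 1 cu ha na (is_op_form (icomm_op hFv hb) hO).
  rewrite (icommZ _ ha iu (is_op_form (icomm_op hFv hb) hO)) scale1r => ->.
  by rewrite scaler0.
rewrite addrA (icomm_compose hFu iv hus hO) usum_flip // usum_nill //.
  by rewrite /= sdeg_nil mul0r sgn0 scale1r.
move=> a b [ha hb _ _] na.
have := icomm_ins_0 1 cv ha na hO; rewrite (icommZ _ ha iv hO) scale1r => ->.
by rewrite (is_op0 (icomm_op hFu hb)) !scaler0.
Qed.

End Operators.

(** * The bracket as an iterated commutator *)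

(** The list version of [deg_subst]: the two total degrees can differ only if some f z is 0, and
    then the multilinear [F] vanishes. *)
Lemma sdeg_map_subst (K : fieldType) (U V : gradedModule K) (W : lmodType K)
    (F : seq V -> W) (f : U -> V) (zs : seq U) (t : seq V) (g : int -> K) :
  multilinear V F -> (forall d z, gm_comp U d z -> gm_comp V d (f z)) ->
  homogl U zs -> homogl V t ->
  g (sdeg V (map f zs)) *: F (map f zs ++ t) = g (sdeg U zs) *: F (map f zs ++ t).
Proof.
move=> + fc; elim: zs F g => [|z zs IH] F g lF; first by rewrite /= !sdeg_nil.
move=> /homogl_cons[hz hzs] ht; rewrite /= !sdeg_cons.
have hfz := fc _ _ (comp_deg hz).
have hfzs : homogl V (map f zs ++ t).
  apply/homogl_cat; split=> // v /mapP[y yzs ->].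
  by exists (deg U y); apply/fc/comp_deg/hzs.
rewrite (deg_subst (fun i => g (i + _)) hfz); last first.
  by move=> e; rewrite e; apply: (multilinear0 lF (@homogl_nil _ V) hfzs).
apply: (IH (fun s => F (f z :: s)) (fun i => g (deg U z + i))) => //.
move=> d s1 s2 c x y h1 h2 hx hy; rewrite -!cat_cons (lF d) //.
by apply/homogl_cons; split=> //; exists (deg U z).
Qed.

Section Generators.
Variables (K : fieldType) (A : gcAlgebra K) (L P : gMod A).
Variables (X : seq L -> L) (symb : seq L -> A -> A) (LR : LRinfty X symb).
Variables (nabla : seq L -> P -> P) (conn : connection symb nabla).
Variables (S : symAlgebra L).
Variables (ins : S -> Forms L P -> Forms L P) (insP : insertion ins).
Local Notation sgn := (@sgn K).
Local Notation op := (Forms L P -> Forms L P).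
Local Notation Dker := (differential_kernel X nabla).
Implicit Types (Om : Forms L P) (s : seq L).

Lemma ins_sa_L d f z Om : gm_comp L f z -> is_form d Om ->
  ins (sa_L S z) Om = (fun s => sgn (f * d) *: Om (z :: s)) :> (seq L -> P).
Proof.
move=> hz hO; have hz1 : homogl L [:: z] by apply/homogl_cons; split=> //; exists f.
have := ins_prod insP hz1 hO; rewrite big_seq1 => ->.
apply/funext => s /=; rewrite sdeg_cons sdeg_nil addr0.
case: (pselect (homogl L s)) => hs; last first.
  by rewrite (form_norm hO) ?scaler0 // => /homogl_cons[].
rewrite (deg_subst (fun i => sgn (i * _)) hz) // => ->.
exact: (glinear0 (form_lin1 hO hs)).
Qed.

(** The second field expresses that [phi] sees the form only through its value on [b]: inserting z
    into the form prepends z to [b], with the sign for passing the form and [a]. *)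
Record kernel_op (F : op) (phi : int -> Forms L P -> seq L -> seq L -> P) : Prop := {
  kernel_opE : forall d Om s, is_form d Om -> homogl L s -> F Om s = usum s (phi d Om);
  kernel_op_ins : forall d Om z a b, is_form d Om -> homog L z -> homogl L a ->
    homogl L b ->
    phi (d + deg L z) (ins (sa_L S z) Om) a b
    = sgn (deg L z * (d + sdeg L a)) *: phi d Om a (z :: b) }.

(* Commuting F with i_z cancels the splittings that put z into the form and
   leaves those that put z into the kernel. *)
Lemma icomm_kernel e F phi zs d Om s : is_op e F -> kernel_op F phi ->
  homogl L zs -> is_form d Om -> homogl L s ->
  icomm S ins e F (map (sa_L S) zs) Om s
  = ((-1) ^+ size zs * sgn (d * sdeg L zs)) *: usum s (fun a b => phi d Om (zs ++ a) b).
Proof.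
move=> + + + hO hs; elim: zs e F phi => [|z zs IH] e F phi hF kF.
  by rewrite /= sdeg_nil mulr0 sgn0 mulr1 scale1r (kernel_opE kF hO hs).
move=> /homogl_cons[hz hzs]; have cz := comp_sa_L S (comp_deg hz).
have hzs' : homogl S (map (sa_L S) zs).
  by move=> v /mapP[y yzs ->]; exists (deg L y); apply/comp_sa_L/comp_deg/hzs.
rewrite [map _ _]/= (icomm_cons insP hF cz hzs' hO).
(* The commutator with i_z has again a kernel, namely [phi] with z fixed in its left block; this
   closes the induction. *)
rewrite (IH _ _ (fun d Om a b => (- sgn (deg L z * d)) *: phi d Om (z :: a) b)) //;
  last 2 first.
- by apply: gcomm_op => //; apply: ins_op.
- move=> {IH}; split=> [{}d {}Om {}s {}hO {}hs|{}d {}Om w a b {}hO hw ha hb].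
    rewrite -[LHS]/(F (ins (sa_L S z) Om) s
      - sgn (e * deg L z) *: ins (sa_L S z) (F Om) s).
    have hFO := is_op_form hF hO.
    rewrite (ins_sa_L (comp_deg hz) hFO) (kernel_opE kF (ins_form insP cz hO) hs).
    rewrite (kernel_opE kF hO) /=; last exact/homogl_cons.
    rewrite scalerA scalerDr -!usumZ opprD addrCA -[RHS]addr0; congr (_ + _).
      rewrite -scaleN1r -usumZ; apply: usum_ext => a b; rewrite !scalerA.
      by congr (_ *: _); rewrite mulN1r; congr (- _); sign_tac.
    apply/eqP; rewrite subr_eq0; apply/eqP; apply: eq_usum => // a b [ha hb _ _].
    by rewrite (kernel_op_ins kF) // !scalerA; congr (_ *: _); sign_tac.
  rewrite (kernel_op_ins kF) //; last exact/homogl_cons.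
  by rewrite !scalerA sdeg_cons; congr (_ *: _); rewrite mulNr mulrN; congr (- _);
    sign_tac.
rewrite -!usumZ; apply: usum_ext => a b; rewrite scalerA sdeg_cons /= exprS.
by congr (_ *: _); rewrite mulrN mulN1r mulNr -mulrA; congr (- (_ * _)); sign_tac.
Qed.

Lemma Dop_op k : is_op 1 (Dop X nabla k.+1).
Proof.
split=> [d Om|]; first exact: (Dop_form LR conn).
exact (Dop_glinear X conn k.+1).
Qed.

Lemma Dop_kernel k : kernel_op (Dop X nabla k.+1) (Dker k.+1).
Proof.
split=> [d Om s hO hs|d Om z a b hO hz ha hb]; first exact (DopE X conn k.+1 hO hs).
rewrite /differential_kernel (ins_sa_L (comp_deg hz) hO) scalerBr.
have hzb : homogl L (z :: b) by apply/homogl_cons.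
have hX := lr_deg LR ha.
congr (_ - _); case: eqP => _; rewrite ?scaler0 //.
  rewrite (glinearZ _ (conn_klin conn ha) (form_deg hO hzb)) !scalerA.
  by congr (_ *: _); sign_tac.
rewrite (form_swap hO (s := [::])) //; last by exists (1 + sdeg L a).
rewrite cat0s (@deg_subst _ _ _ _ _ _ (fun i => sgn (deg L z * i)) hX); last first.
  by move=> ->; rewrite (glinear0 (form_lin1 hO hzb)).
by rewrite !scalerA; congr (_ *: _); sign_tac.
Qed.

Variables (Lam : seq S -> S) (LamP : bracket X symb Lam).

Lemma homogl_map_L zs : homogl L zs -> homogl S (map (sa_L S) zs).
Proof.
by move=> hzs v /mapP[y yzs ->]; exists (deg L y); apply/comp_sa_L/comp_deg/hzs.
Qed.

Lemma Dker_nil k d Om zs s a b : size zs = k.+1 -> splits s a b -> a <> [::] ->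
  Dker k.+1 d Om (zs ++ a) b = 0.
Proof.
move=> zk _; case: a => [//|x a] _; rewrite /differential_kernel size_cat zk /=.
have h : (k.+1 < k.+1 + (size a).+1)%N by rewrite addnS ltnS leq_addr.
by rewrite (gtn_eqF h) (gtn_eqF (ltnW h)) subr0.
Qed.

(** With k + 1 entries the left block is full, so the rest of the list goes to the form. Only the
    [X] term of D_(k+1) accepts a block of this length, and its minus sign is the one in the
    constant. *)
Lemma icomm_Dop_L k zs d Om : homogl L zs -> size zs = k.+1 -> is_form d Om ->
  icomm S ins 1 (Dop X nabla k.+1) (map (sa_L S) zs) Om
  = - (-1) ^+ k.+1 *: ins (Lam (map (sa_L S) zs)) Om.
Proof.
move=> hzs zk hO; rewrite (br_X LamP hzs) (ins_sa_L (lr_deg LR hzs) hO).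
apply/funext => s; rewrite -[RHS]/(_ *: (_ *: Om (X zs :: s))).
have hD := is_op_form (icomm_op insP (Dop_op k) (homogl_map_L hzs)) hO.
case: (pselect (homogl L s)) => hs; last first.
  by rewrite (form_norm hD) ?(form_norm hO) ?scaler0 // => /homogl_cons[].
rewrite (icomm_kernel (Dop_op k) (Dop_kernel k) hzs hO hs) usum_nill //; last first.
  by move=> a b sab na; apply: Dker_nil sab na.
rewrite cats0 /differential_kernel zk eqxx /= (gtn_eqF (ltnSn k)) sub0r !scalerN !scalerA.
by rewrite mulNr scaleNr; congr (- (_ *: _)); rewrite -mulrA; congr (_ * _); sign_tac.
Qed.

Definition symbol_ker k al (a0 : A) d Om (a b : seq L) : P :=
  if size a == k then sgn ((d + al) * sdeg L a) *: act (symb a a0) (Om b) else 0.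

(** Multiplication by [a0] graded-commutes with the [X] term and with the A-linear part of the
    connection, so the commutator retains only the symbol from the Leibniz rule. *)
Lemma symbol_kernel k a0 al : gm_comp A al a0 ->
  kernel_op (gcomm 1 al (Dop X nabla k.+1) (ins (sa_A S a0))) (symbol_ker k al a0).
Proof.
move=> ha0; have ca := comp_sa_A S ha0; have hha0 : homog A a0 by exists al.
split=> [d Om s hO hs|d Om z a b hO hz ha hb]; last first.
  rewrite /symbol_ker (ins_sa_L (comp_deg hz) hO); case: eqP => _; rewrite ?scaler0 //.
  by rewrite act_Zr !scalerA; congr (_ *: _); sign_tac.
have hiO := ins_form insP ca hO.
rewrite -[LHS]/(Dop X nabla k.+1 (ins (sa_A S a0) Om) s
  - sgn (1 * al) *: ins (sa_A S a0) (Dop X nabla k.+1 Om) s).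
rewrite (ins_sa_A insP hha0 (is_op_form (Dop_op k) hO)).
rewrite (DopE X conn k.+1 hO hs) (DopE X conn k.+1 hiO hs).
rewrite (@usum_map _ _ _ _ (act a0)); last by move=> c x y; rewrite act_linr.
rewrite addrC -scaleNr -usumP; apply: eq_usum => // a b [ha hb _ _].
rewrite /differential_kernel /symbol_ker /= (ins_sa_A insP hha0 hO).
have hOb := form_deg hO hb.
rewrite (conn_leibniz conn ha hha0 (form_homog hO hb)).
have hal (W : lmodType K) (w : W) (f : int -> K) : (a0 = 0 -> w = 0) ->
  f (deg A a0) *: w = f al *: w by apply: (deg_subst f ha0).
rewrite (hal _ _ (fun i => sgn (_ * i))); last by move=> ->; rewrite act_0l.
rewrite act_Dr act_Nr scalerDr scalerN addrACA -opprD.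
have [ak|nk] := eqVneq (size a) k.
  rewrite ak (ltn_eqF (ltnSn k)) act0r scaler0 addr0 subr0.
  rewrite act_Zr scalerDr !scalerA addrA -[RHS]add0r; congr (_ + _).
  by rewrite -scalerDl -[RHS](scale0r (act a0 (nabla a (Om b)))); congr (_ *: _);
    rewrite mulNr addrC; apply/eqP; rewrite subr_eq0; apply/eqP; sign_tac.
rewrite !act0r scaler0 !add0r; case: eqP => _; last by rewrite act0r scaler0 addr0 oppr0.
rewrite act_Zr !scalerA -scalerDl -[RHS]oppr0 -(scale0r (act a0 (Om (X a :: b)))).
congr (- (_ *: _)); rewrite mulNr addrC; apply/eqP; rewrite subr_eq0; apply/eqP; sign_tac.
Qed.

Let Lam_swap : @swap_symmetric K S S Lam := gsymmetric_swap (br_sym LamP).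

Lemma Lam_A_head zs a0 : homogl L zs -> homog A a0 ->
  Lam (sa_A S a0 :: map (sa_L S) zs) = sgn (deg A a0 * sdeg L zs) *: sa_A S (symb zs a0).
Proof.
move=> hzs ha0; have ca := comp_sa_A S (comp_deg ha0).
have hn := @homogl_nil _ S; have hm := homogl_map_L hzs.
have := swap_front Lam_swap hm (homog_comp ca) hn; rewrite cats0.
rewrite (deg_subst (fun i => sgn (i * _)) ca); last first.
  by move=> ->; rewrite (multilinear0 (br_lin LamP) hn hm).
have lin : @multilinear K S S (fun us => Lam (sa_A S a0 :: us)).
  move=> d us vs c x y hus hvs hx hy; rewrite -!cat_cons (br_lin LamP (d := d)) //.
  by apply/homogl_cons; split=> //; exists (deg A a0).
have := sdeg_map_subst (fun i => sgn (deg A a0 * i)) lin (comp_sa_L S) hzs hn.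
rewrite !cats0 => -> e.
rewrite -(br_symb LamP hzs ha0) -cats1 e scalerA sgnn scale1r //.
Qed.

Lemma icomm_Dop_A k zs a0 d Om : homogl L zs -> homog A a0 -> size zs = k ->
  is_form d Om ->
  icomm S ins 1 (Dop X nabla k.+1) (sa_A S a0 :: map (sa_L S) zs) Om
  = - (-1) ^+ k.+1 *: ins (Lam (sa_A S a0 :: map (sa_L S) zs)) Om.
Proof.
move=> hzs ha0 zk hO; have ca := comp_sa_A S (comp_deg ha0).
have hs0 := symb_comp LR hzs (comp_deg ha0).
rewrite (icomm_cons insP (Dop_op k) ca (homogl_map_L hzs) hO) Lam_A_head //.
rewrite (glinearZ _ (ins_glinear insP hO) (comp_sa_A S hs0)).
rewrite (ins_sa_A insP (homog_comp hs0) hO).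
have hG := gcomm_op (Dop_op k) (ins_op insP ca).
apply/funext => s; rewrite -[RHS]/(_ *: (_ *: act _ (Om s))).
have hD := is_op_form (icomm_op insP hG (homogl_map_L hzs)) hO.
case: (pselect (homogl L s)) => hs; last first.
  by rewrite (form_norm hD) // (form_norm hO) // act0r !scaler0.
rewrite (icomm_kernel hG (symbol_kernel k (comp_deg ha0)) hzs hO hs).
rewrite usum_nill //; last first.
  move=> a b _; case: a => [//|x a] _; rewrite /symbol_ker size_cat zk /=.
  by rewrite gtn_eqF // addnS ltnS leq_addr.
rewrite cats0 /symbol_ker zk eqxx !scalerA exprS; congr (_ *: _).
by rewrite mulN1r opprK -mulrA; congr (_ * _); sign_tac.
Qed.

(** The first commutator multiplies values of the form by symbols, and this commutes with
    multiplication by b. It matches [br_AA]. *)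
Lemma icomm_Dop_AA k a b us d Om : homog A a -> homog A b -> homogl S us ->
  is_form d Om ->
  icomm S ins 1 (Dop X nabla k.+1) (sa_A S a :: sa_A S b :: us) Om = 0.
Proof.
move=> ha hb hus hO; have [ca cb] := (comp_sa_A S (comp_deg ha), comp_sa_A S (comp_deg
  hb)).
have hbus : homogl S (sa_A S b :: us) by apply/homogl_cons; split=> //; exists (deg A b).
rewrite (icomm_cons insP (Dop_op k) ca hbus hO).
have hG := gcomm_op (Dop_op k) (ins_op insP ca).
rewrite (icomm_cons insP hG cb hus hO).
apply: (icomm_0 insP hus (gcomm_op hG (ins_op insP cb)) _ hO) => {hO} {}d {}Om hO.
have hiO := ins_form insP cb hO; have hGO := is_op_form hG hO.
have kG := symbol_kernel k (comp_deg ha); set G := gcomm 1 _ _ _ in hG hGO kG *.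
apply/funext => s; rewrite -[LHS]/(G (ins (sa_A S b) Om) s - _ *: ins (sa_A S b) (G Om)
  s).
case: (pselect (homogl L s)) => hs; last first.
  rewrite (form_norm (is_op_form hG hiO)) // (form_norm (ins_form insP cb hGO)) //.
  by rewrite scaler0 subr0.
rewrite (ins_sa_A insP hb hGO) (kernel_opE kG hO hs) (kernel_opE kG hiO hs).
rewrite (@usum_map _ _ _ _ (act b)); last by move=> c x y; rewrite act_linr.
apply/eqP; rewrite -usumZ subr_eq0; apply/eqP; apply: eq_usum => // a' b' [ha' hb' _ _].
rewrite /symbol_ker (ins_sa_A insP hb hO); case: eqP => _; rewrite ?act0r ?scaler0 //.
rewrite -act_mul (ga_comm (symb_comp LR ha' (comp_deg ha)) (comp_deg hb)).
by rewrite act_Zl act_Zr act_mul !scalerA; congr (_ *: _); sign_tac.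
Qed.

Definition bracket_law k (us : seq S) : Prop :=
  forall d Om, is_form d Om ->
    icomm S ins 1 (Dop X nabla k.+1) us Om = - (-1) ^+ k.+1 *: ins (Lam us) Om.

(** Both sides of the law are graded symmetric, so moving v to the front multiplies them by the same
    sign. *)
Lemma bracket_law_front k us v vs : homogl S us -> homog S v -> homogl S vs ->
  bracket_law k (us ++ v :: vs) <-> bracket_law k (v :: us ++ vs).
Proof.
move=> hus hv hvs.
have hl : homogl S (v :: us ++ vs) by apply/homogl_cons; split=> //; apply/homogl_cat.
have hLam := br_deg LamP hl.
have eq d Om (hO : is_form d Om) := swap_front (icomm_swap insP (Dop_op k) hO) hus hv hvs.
have eqL d Om (hO : is_form d Om) : ins (Lam (us ++ v :: vs)) Om
    = sgn (deg S v * sdeg S us) *: ins (Lam (v :: us ++ vs)) Om.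
  rewrite (swap_front Lam_swap hus hv hvs).
  exact: (glinearZ _ (ins_glinear insP hO) hLam).
split=> law d Om hO.
  have := law d Om hO; rewrite (eq d Om hO) (eqL d Om hO).
  move/(congr1 (fun w => sgn (deg S v * sdeg S us) *: w)).
  rewrite !scalerA sgnn scale1r => ->; congr (_ *: _).
  by rewrite mulrAC sgnn mul1r.
rewrite (eq d Om hO) (eqL d Om hO) (law d Om hO) !scalerA; congr (_ *: _).
exact: mulrC.
Qed.

Inductive generator : S -> Prop :=
| generator_A a : homog A a -> generator (sa_A S a)
| generator_L x : homog L x -> generator (sa_L S x).

Lemma generator_homog u : generator u -> homog S u.
Proof.
by case=> [a|x] h; [exists (deg A a); apply: comp_sa_A | exists (deg L x);
  apply: comp_sa_L];
  apply: comp_deg.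
Qed.

Lemma generators_cases (us : seq S) : (forall u, u \in us -> generator u) ->
  (exists2 zs, homogl L zs & us = map (sa_L S) zs) \/
  (exists vs a ws, homog A a /\ us = vs ++ sa_A S a :: ws).
Proof.
elim: us => [_|u us IH hus]; first by left; exists [::].
have hu : generator u by apply: hus; rewrite inE eqxx.
have [|[zs hzs e]|[vs [a [ws [ha e]]]]] := IH.
- by move=> v vus; apply: hus; rewrite inE vus orbT.
- case: hu hus => [a ha|x hx] _; first by right; exists [::], a, us.
  by left; exists (x :: zs); [apply/homogl_cons | rewrite e].
- by right; exists (u :: vs), a, ws; rewrite e.
Qed.

Lemma bracket_law_generators k (us : seq S) :
  (forall u, u \in us -> generator u) -> size us = k.+1 -> bracket_law k us.
Proof.
move=> gus sus; have hgus : homogl S us by move=> u /gus /generator_homog.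
have [[zs hzs e]|[vs [a [ws [ha e]]]]] := generators_cases gus.
  move=> d Om hO; rewrite e; apply: (icomm_Dop_L hzs _ hO).
  by rewrite -sus e size_map.
have gvws u : u \in vs ++ ws -> generator u.
  move=> uvw; apply: gus; rewrite e; move: uvw; rewrite !mem_cat inE => /orP[->//|->].
  by rewrite !orbT.
have hvws : homogl S (vs ++ ws) by move=> u /gvws /generator_homog.
have [hvs hws] := (homogl_cat (V := S) vs ws).1 hvws.
have ca := comp_sa_A S (comp_deg ha).
(* With one entry from [A] in front, either all the others come from [L], or a second one comes from
   [A] and both sides vanish. *)
rewrite e; apply/bracket_law_front => //; first exact: homog_comp ca.
have [[zs hzs e']|[vs' [b [ws' [hb e']]]]] := generators_cases gvws.
  move=> d Om hO; rewrite e'; apply: (icomm_Dop_A hzs ha _ hO).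
  by apply/eqP; rewrite -eqSS -sus e -(size_map (sa_L S)) -e' !size_cat /= addnS.
have cb := comp_sa_A S (comp_deg hb).
move: hvws; rewrite e' => /homogl_cat[hvs' /homogl_cons[_ hws']] d Om hO.
rewrite (br_AA LamP (us := [::])) // (glinear0 (ins_glinear insP hO)) scaler0.
have sym := swap_symmetric_cons (homog_comp ca) (icomm_swap insP (Dop_op k) hO).
rewrite (swap_front sym) //; last exact: homog_comp cb.
by rewrite (icomm_Dop_AA _ ha hb _ hO) ?scaler0 //; apply/homogl_cat.
Qed.

(* Both sides are linear derivations in each argument, so that arbitrary
   arguments can be traded for generators one at a time. *)
Lemma icomm_Dop_bracket k (us : seq S) d Om :
  homogl S us -> size us = k.+1 -> is_form d Om ->
  icomm S ins 1 (Dop X nabla k.+1) us Om = - (-1) ^+ k.+1 *: ins (Lam us) Om.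
Proof.
(* The tail [gs] makes the induction work: once the head is replaced by a generator, it is moved
   behind [us] and joins [gs]. *)
move=> hus sus hO; suff law gs : (forall u, u \in gs -> generator u) ->
    size (us ++ gs) = k.+1 -> bracket_law k (us ++ gs).
  by have := law [::]; rewrite cats0 => /(_ _ sus d Om hO); apply.
elim: us gs hus {sus hO} => [|u us IH] gs; first by move=> _ /bracket_law_generators;
  apply.
move=> /homogl_cons[hu hus] ggs sus.
have hgs : homogl S gs by move=> v /ggs /generator_homog.
have hugs : homogl S (us ++ gs) by apply/homogl_cat.
have gen v : generator v -> bracket_law k (v :: us ++ gs).
  move=> gv; apply/bracket_law_front => //; first exact: generator_homog.
  apply: IH => //; last by rewrite -sus !size_cat /= addnS.
  by move=> w; rewrite inE => /orP[/eqP->|/ggs].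
rewrite cat_cons; apply: (@sym_ind K A L S (fun w => bracket_law k (w :: us ++ gs)) _ _
  _ _ u hu) => {u hu sus} [e c u v hu hv Eu Ev|a ha|x hx|u v hu hv Eu Ev].
- move=> i Om1 hO.
  rewrite (icomm_glinear insP (Dop_op k) hugs hO c hu hv) (Eu _ _ hO) (Ev _ _ hO).
  have lin : glinear S (fun w => Lam (w :: us ++ gs)).
    exact (multilinear_glinear (br_lin LamP) (@homogl_nil _ S) hugs).
  have cLam w : gm_comp S e w -> gm_comp S (1 + (e + sdeg S (us ++ gs))) (Lam (w :: us
    ++ gs)).
    move=> hw; have [->|nw] := eqVneq w 0; first by rewrite (glinear0 lin);
      apply: gm_comp0.
    rewrite -(comp_uniq (comp_deg (homog_comp hw)) hw nw) -sdeg_cons.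
    by apply: (br_deg LamP); apply/homogl_cons; split=> //; exists e.
  rewrite (lin e) // (ins_glinear insP hO c (cLam u hu) (cLam v hv)).
  by rewrite scalerDr !scalerA [c * _]mulrC.
- by apply: gen; constructor.
- by apply: gen; constructor.
move=> i Om1 hO; rewrite (icomm_mul insP (Dop_op k) hu hv hugs hO).
rewrite (Eu _ _ (ins_form insP (comp_deg hv) hO)) (Ev _ _ hO).
have hl w : homog S w -> homogl S (w :: us ++ gs) by move=> hw; apply/homogl_cons.
have [lu lv] := (br_deg LamP (hl u hu), br_deg LamP (hl v hv)).
have := br_der LamP (@homogl_nil _ S) hugs hu hv; rewrite !cat0s => ->.
have clu : gm_comp S _ _ := ga_mul lu (comp_deg hv).
have clv : gm_comp S _ _ := ga_mul (comp_deg hu) lv.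
rewrite (_ : deg S u + _ = 1 + sdeg S (u :: us ++ gs) + deg S v) in clv; last first.
  by rewrite !sdeg_cons; ring.
rewrite (glinearD (ins_glinear insP hO) (compZ _ clu) (compZ _ clv)).
rewrite (glinearZ _ (ins_glinear insP hO) clu) (glinearZ _ (ins_glinear insP hO) clv).
rewrite (ins_mul insP (homog_comp lu) hv hO) (ins_mul insP hu (homog_comp lv) hO).
rewrite (glinearZ _ (ins_linr insP hu) (ins_form insP lv hO)).
rewrite addrC scalerDr !scalerA sdeg_nil addr0.
by congr (_ *: _ + _ *: _); apply: mulrC.
Qed.

End Generators.

(** * Curvature *)

(** To be used with m the length of the left block; the two conditionals account for a neighbour of
    m that falls outside the range. *)
Lemma sum_ord_near (W : nmodType) n m (t : nat -> W) : (m <= n)%N ->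
  (forall i, (i <= n)%N -> (i.+1 < m)%N || (m.+1 < i)%N -> t i = 0) ->
  \sum_(i < n.+1) t i
  = (if m is m'.+1 then t m' else 0) + t m + (if (m < n)%N then t m.+1 else 0).
Proof.
move=> mn t0.
transitivity (\sum_(i < n.+1) ((if i.+1 == m then t i else 0)
    + (if i == m :> nat then t i else 0) + (if i == m.+1 :> nat then t i else 0))).
  apply: eq_bigr => i _; have := t0 i (ltn_ord i).
  case: (ltngtP i.+1 m) => h.
  - rewrite (_ : _ == m = false) 1?(_ : _ == m.+1 = false); try lia.
    by rewrite !addr0 => ->.
  - have [->|ni] := eqVneq (i : nat) m; first by rewrite ltn_eqF // add0r addr0.
    have [->|ni'] := eqVneq (i : nat) m.+1; first by rewrite !add0r.
    by rewrite !addr0 => -> //; lia.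
  - by rewrite -h !ltn_eqF ?ltnS // !addr0.
rewrite !big_split /= -!big_mkcond /=; congr (_ + _ + _).
- case: m mn {t0} => [|m] mn; first by rewrite big_pred0.
  by rewrite (eq_bigl (fun i : 'I_n.+1 => i == m :> nat)) ?big_ord1_eq ?ltnS ?(ltnW mn).
- by rewrite big_ord1_eq ltnS mn.
- by rewrite big_ord1_eq ltnS.
Qed.

Section Curvature.
Variables (K : fieldType) (charK : [pchar K] =i pred0).
Variables (A : gcAlgebra K) (L P : gMod A).
Variables (X : seq L -> L) (symb : seq L -> A -> A) (LR : LRinfty X symb).
Variables (nabla : seq L -> P -> P) (conn : connection symb nabla).
Variables (S : symAlgebra L).
Variables (ins : S -> Forms L P -> Forms L P) (insP : insertion ins).
Variables (Lam : seq S -> S) (LamP : bracket X symb Lam).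
Local Notation sgn := (@sgn K).
Local Notation D k := (Dop X nabla k.+1).
Local Notation Lnabla := (Lconn X nabla S ins).
Implicit Types (Om : Forms L P) (us : seq S).

Lemma LconnE us Om : Lnabla us Om = (-1) ^+ size us *: icomm S ins 1 (D (size us)) us Om.
Proof. by rewrite /Lconn exprS mulN1r opprK. Qed.

Lemma Lconn_op us : homogl S us -> is_op (1 + sdeg S us) (Lnabla us).
Proof.
move=> hus; have hI := icomm_op insP (Dop_op LR conn (size us)) hus.
split=> [d Om hO|d c Om Om' hO hO']; rewrite !LconnE.
  by apply: (compZ (V := Forms L P)); apply: is_op_form hI hO.
by rewrite (is_opP _ hI hO hO') scalerDr !scalerA [c * _]mulrC.
Qed.

(** The first k + 1 commutators turn D_(k+1) into a multiple of an insertion, which commutes with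
    all the remaining ones. *)
Lemma icomm_Dop_0 k us d Om : homogl S us -> (k.+1 < size us)%N -> is_form d Om ->
  icomm S ins 1 (D k) us Om = 0.
Proof.
move=> hus kus hO; rewrite -(cat_take_drop k.+1 us).
set vs := take _ _; set ws := drop _ _.
have [hvs hws] : homogl S vs /\ homogl S ws.
  by apply/homogl_cat; rewrite cat_take_drop.
have svs : size vs = k.+1 by rewrite size_takel // ltnW.
rewrite icomm_cat (icomm_eq insP _ hws (G :=
  fun Om => - (-1) ^+ k.+1 *: ins (Lam vs) Om) _ hO).
  apply: (icomm_ins_0 insP _ (br_deg LamP hvs) hws _ hO) => w0.
  by move: kus; rewrite -(cat_take_drop k.+1 us) -/vs -/ws w0 cats0 svs ltnn.
by move=> d' Om' hO'; apply: (icomm_Dop_bracket LR conn insP LamP hvs svs hO').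
Qed.

(** The D_i are odd, so their graded commutators are anticommutators. Reversing the index identifies
    the two halves of the sum, and 2 is invertible in characteristic 0. *)
Lemma JopE k d Om : is_form d Om -> Jop X nabla k.+1 Om = \sum_(i < k.+1) D i (D (k -
  i) Om).
Proof.
move=> hO; have two : (2%:R : K) != 0.
  by rewrite -(negbK (_ == _)); have := charK 2; rewrite !inE /= => ->.
rewrite /Jop big_add1 /= big_mkord.
transitivity ((2%:R^-1 : K) *: (\sum_(i < k.+1) D i (D (k - i) Om) + \sum_(i < k.+1) D
  (k - i) (D i Om))).
  congr (_ *: _); rewrite -big_split; apply: eq_bigr => i _.
  by rewrite /gcomm mulr1 sgn1 scaleN1r opprK subSS subSn // -ltnS.
have -> : \sum_(i < k.+1) D (k - i) (D i Om) = \sum_(i < k.+1) D i (D (k - i) Om).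
  rewrite (reindex_inj rev_ord_inj); apply: eq_bigr => i _.
  have e : (k - (k.+1 - i.+1) = i)%N by rewrite subSS subKn // -ltnS.
  by rewrite [nat_of_ord (rev_ord i)]/= e subSS.
by rewrite -mulr2n -scaler_nat scalerA mulVf ?scale1r.
Qed.

(** Here [D i] is D_(i+1), so the surviving indices are |a| - 1, |a| and |a| + 1: below them the
    commutators with [a] vanish, above them those with [b]. At the two extremes [icomm_Dop_bracket]
    applies. *)
Lemma curvature_kernel (us a b : seq S) d Om :
  homogl S us -> @splits K S us a b -> is_form d Om ->
  \sum_(i < (size us).+1) icomm S ins 1 (D i) a (icomm S ins 1 (D (size us - i)) b Om)
  = - (-1) ^+ size a *: ins (Lam a) (icomm S ins 1 (D (size b).+1) b Om)
    + icomm S ins 1 (D (size a)) a (icomm S ins 1 (D (size b)) b Om)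
    + - (-1) ^+ size b *: icomm S ins 1 (D (size a).+1) a (ins (Lam b) Om).
Proof.
move=> hus [ha hb ab0 _] hO.
have ab : (size a + size b)%N = size us := ab0.
have hIb k := is_op_form (icomm_op insP (Dop_op LR conn k) hb) hO.
pose t i := icomm S ins 1 (D i) a (icomm S ins 1 (D (size us - i)) b Om).
have asz : (size a <= size us)%N by rewrite -ab leq_addr.
rewrite (sum_ord_near (t := t) asz); last first.
  move=> i i_n /orP[ia|ai]; rewrite /t.
    exact: icomm_Dop_0 ha ia (hIb _).
  rewrite (icomm_Dop_0 hb _ hO); last by lia.
  exact: (is_op0 (icomm_op insP (Dop_op LR conn i) ha)).
rewrite /t -ab addKn; congr (_ + _ + _).
  (* For empty [a] the index |a| - 1 does not exist, and the term on the right vanishes as well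
     because the empty bracket is 0. The same happens for empty [b] at the other end. *)
  case: (a) ha => [|x a'] ha.
    by rewrite (br_nil LamP) (glinear0 (ins_glinear insP (hIb _))) scaler0.
  rewrite -[LHS]/(icomm S ins 1 (D (size a')) (x :: a')
    (icomm S ins 1 (D ((size a').+1 + size b - size a')) b Om)).
  rewrite (icomm_Dop_bracket LR conn insP LamP ha _ (hIb _)) //.
  by rewrite (_ : (size a').+1 + size b - size a' = (size b).+1)%N //; lia.
case: (b) hb => [|x b'] hb.
  rewrite addn0 ltnn (br_nil LamP) (glinear0 (ins_glinear insP hO)).
  by rewrite (is_op0 (icomm_op insP (Dop_op LR conn _) ha)) scaler0.
rewrite -[X in (X < _)%N]addn0 ltn_add2l [(0 < _)%N]/= [size (x :: b')]/=.
rewrite (_ : size a + (size b').+1 - (size a).+1 = size b')%N; last by lia.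
rewrite (icomm_Dop_bracket LR conn insP LamP hb _ hO) //.
exact: (is_opZ _ (icomm_op insP (Dop_op LR conn _) ha) (ins_form insP (br_deg LamP hb)
  hO)).
Qed.

(** By symmetry the bracket is moved from the first to the last place, so that the outermost
    commutator is the one with its insertion and can be expanded. *)
Lemma Lconn_bracket_head (a b : seq S) d Om : homogl S a -> homogl S b -> is_form d Om ->
  Lnabla (Lam a :: b) Om
  = ((-1) ^+ (size b).+1 * sgn ((1 + sdeg S a) * sdeg S b)) *:
      icomm S ins 1 (D (size b).+1) b (ins (Lam a) Om)
    - ((-1) ^+ (size b).+1 * sgn (1 + sdeg S a)) *:
      ins (Lam a) (icomm S ins 1 (D (size b).+1) b Om).
Proof.
move=> ha hb hO; have hLa := br_deg LamP ha; have hn := @homogl_nil _ S.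
have hD := Dop_op LR conn (size b).+1.
have hI := icomm_op insP hD hb.
rewrite LconnE [size (_ :: _)]/=.
have := swap_front (icomm_swap insP hD hO) hb (homog_comp hLa) hn.
rewrite cats0 icomm_cat (icomm_cons insP hI hLa hn hO) [icomm _ _ _ _ [::]]/=.
rewrite (@deg_subst _ _ _ _ _ _ (fun i => sgn (i * _)) hLa); last first.
  by move=> e; rewrite e (glinear0 (icomm_glinear insP hD hb hO)).
move/(congr1 (fun w => sgn ((1 + sdeg S a) * sdeg S b) *: w)).
rewrite [in RHS]scalerA sgnn scale1r => <-.
rewrite /gcomm scalerBr scalerBr !scalerA; congr (_ - _ *: _).
by rewrite -mulrA; congr (_ * _); sign_tac.
Qed.

Lemma Lconn_curvature us d Om : homogl S us -> is_form d Om ->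
  curv S (Forms L P) Lam Lnabla us Om
  = - ((-1) ^+ (size us).+1 : K) *: icomm S ins 2 (Jop X nabla (size us).+1) us Om.
Proof.
move=> hus hO; rewrite /curv (@unshuffle_usum_all K S (Forms L P) us (fun a b =>
  Lnabla (Lam a :: b) Om + sgn (sdeg S a) *: Lnabla a (Lnabla b Om)) hus).
set n := size us; rewrite exprS mulN1r opprK.
have hDD i : is_op 2 (fun Om => D i (D (n - i) Om)).
  exact: is_op_comp (Dop_op LR conn i) (Dop_op LR conn (n - i)).
rewrite (icomm_eq insP _ hus (G := fun Om => \sum_(i <- index_enum 'I_n.+1) D i (D (n -
  i) Om)) _ hO);
  last by move=> d' Om' hO'; apply: (JopE _ hO').
rewrite (icomm_sum insP _ (F := fun (i : 'I_n.+1) Om => D i (D (n - i) Om)) hus (fun i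
  => hDD i) hO).
have E (i : 'I_n.+1) : icomm S ins 2 (fun Om => D i (D (n - i) Om)) us Om =
    @usum K S (Forms L P) us (fun a b => sgn (sdeg S a) *:
       icomm S ins 1 (D i) a (icomm S ins 1 (D (n - i)) b Om)).
  rewrite (icomm_compose insP (Dop_op LR conn i) (Dop_op LR conn (n - i)) hus hO).
  by apply: usum_ext => a b; rewrite mul1r.
rewrite (eq_bigr _ (fun i _ => E i)) -usum_sum -usumZ.
(* The commutator is split in two because its first half pairs with the opposite splitting: there
   the bracket is inserted before D acts, and in [curvature_kernel] the block inserted first is the
   right one. Hence only this half is flipped next. *)
transitivity (@usum K S (Forms L P) us (fun a b =>
    ((-1) ^+ (size b).+1 * sgn ((1 + sdeg S a) * sdeg S b)) *:
      icomm S ins 1 (D (size b).+1) b (ins (Lam a) Om))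
  + @usum K S (Forms L P) us (fun a b =>
    - ((-1) ^+ (size b).+1 * sgn (1 + sdeg S a)) *:
      ins (Lam a) (icomm S ins 1 (D (size b).+1) b Om)
    + sgn (sdeg S a) *: Lnabla a (Lnabla b Om))).
  rewrite -usumD; apply: eq_usum => // a b [ha hb _ _]; rewrite addrA; congr (_ + _).
  by rewrite (Lconn_bracket_head ha hb hO) scaleNr.
rewrite usum_flip // -usumD; apply: eq_usum => // a b sab.
rewrite -scaler_sumr (curvature_kernel hus sab hO).
have [ha hb ab _] := sab.
have hIb := is_op_form (icomm_op insP (Dop_op LR conn (size b)) hb) hO.
rewrite !LconnE (is_opZ _ (icomm_op insP (Dop_op LR conn _) ha) hIb).
rewrite /n -ab exprD !exprS !scalerDr !scalerA [RHS]addrC;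
  congr (_ *: _ + (_ *: _ + _ *: _)).
all: have [pp qq] : (-1) ^+ size a * (-1) ^+ size a = 1 :> K
    /\ (-1) ^+ size b * (-1) ^+ size b = 1 :> K by rewrite -!expr2 !sqrr_sign.
all: move: ((-1) ^+ size a) ((-1) ^+ size b) pp qq => p q pp qq.
- have e : sgn (sdeg S a * sdeg S b) * sgn ((1 + sdeg S b) * sdeg S a) = sgn (sdeg S a).
    by sign_tac.
  by rewrite mulrCA e mulN1r mulrN mulrAC -[p * q * q]mulrA qq mulr1 mulNr.
- rewrite sgnD sgn1; move: (sgn (sdeg S a)) => r.
  have -> : p * q * r * - p = - (q * r * (p * p)) by ring.
  by rewrite pp; ring.
- by ring.
Qed.

Lemma Lconn_connection :
  @connection K (groundAlg K) (groundMod S) (fun _ _ => 0) (groundMod (Forms L P)) Lnabla.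
Proof.
have lin Om : homog (Forms L P) Om ->
    multilinear (groundMod S) (fun us => Lnabla us Om : groundMod (Forms L P)).
  move=> [d hO] e us vs c x y hus hvs hx hy; rewrite !LconnE !size_cat /= !icomm_cat.
  have hI := icomm_op insP (Dop_op LR conn (size us + (size vs).+1)) hus.
  rewrite (icomm_glinear insP hI hvs hO c hx hy) scalerDr !scalerA.
  by rewrite [c * _]mulrC.
(* A nonzero scalar has degree 0, so it produces no sign; for the zero scalar the sign multiplies
   0. *)
have ground_deg (a : groundAlg K) : homog (groundAlg K) a ->
  a = 0 \/ deg (groundAlg K) a = 0.
  by move/comp_deg => -[]; [right | left].
split=> //.
- move=> Om [d hO]; apply: swap_gsymmetric => us x y vs hus hx hy hvs.
  rewrite !LconnE !size_cat /= (icomm_swap insP (Dop_op LR conn _) hO hus hx hy hvs).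
  by rewrite !scalerA mulrC.
- move=> Om hO us vs a x hus hvs ha hx.
  have hl := lin Om hO.
  rewrite (glinearZ _ (multilinear_glinear hl hus hvs) (comp_deg hx)).
  have [->|->] := ground_deg a ha; last by rewrite mul0r sgn0 scale1r.
  by rewrite /= /k_act !scale0r scaler0.
- move=> us Om hus hO.
  by rewrite [1 + _ + _]addrC; apply: is_op_form (Lconn_op hus) (comp_deg hO).
- by move=> us hus; case: (Lconn_op hus).
move=> us a Om hus ha hO.
rewrite -[act 0 Om]/((0 : K) *: Om) scale0r addr0.
have opZ (c : K) : Lnabla us (c *: Om) = c *: Lnabla us Om.
  exact: is_opZ (Lconn_op hus) (comp_deg hO).
rewrite -[act a Om]/((a : K) *: Om) -[act a _]/((a : K) *: _) opZ.
have [->|->] := ground_deg a ha; last by rewrite mulr0 sgn0 scale1r.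
by rewrite /= /k_act !scale0r scaler0.
Qed.

(** The iterated commutator over [us] followed by u is the insertion of the bracket; expanding its
    outermost commutator gives the formula. *)
Lemma Lconn_ins us u d Om : homogl S us -> homog S u -> is_form d Om ->
  Lnabla us (ins u Om)
  = ins (Lam (rcons us u)) Om + sgn (deg S u * (sdeg S us + 1)) *: ins u (Lnabla us Om).
Proof.
move=> hus hu hO; have hI := icomm_op insP (Dop_op LR conn (size us)) hus.
have husu : homogl S (rcons us u).
  by rewrite -cats1; apply/homogl_cat; split=> //; apply/homogl_cons.
have := icomm_Dop_bracket LR conn insP LamP husu (size_rcons _ _) hO.
rewrite -cats1 icomm_cat [icomm _ _ _ _ [:: u]]/= /gcomm.
move/(congr1 (fun w => (-1) ^+ size us *: w)).
rewrite scalerA exprS mulN1r opprK -expr2 sqrr_sign scale1r => <-.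
rewrite !LconnE (is_opZ _ (ins_op insP (comp_deg hu)) (is_op_form hI hO)).
rewrite scalerBr -addrA -[LHS]addr0; congr (_ + _); rewrite !scalerA -scaleNr -scalerDl.
rewrite -[LHS](scale0r (ins u (icomm S ins 1 (D (size us)) us Om))); congr (_ *: _).
apply/esym/eqP; rewrite addrC subr_eq0 mulrC; apply/eqP; congr (_ * _); sign_tac.
Qed.

Lemma Lconn_mul u v us d Om : homog S u -> homog S v -> homogl S us -> is_form d Om ->
  Lnabla (u * v :: us) Om
  = sgn (deg S u) *: ins u (Lnabla (v :: us) Om)
    + sgn (deg S v * sdeg S us) *: Lnabla (u :: us) (ins v Om).
Proof.
move=> hu hv hus hO; have hD := Dop_op LR conn (size us).+1.
have hvus : homogl S (v :: us) by apply/homogl_cons.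
have hI := is_op_form (icomm_op insP hD hvus) hO.
rewrite !LconnE ![size (_ :: _)]/= (icomm_mul insP hD hu hv hus hO).
rewrite (is_opZ _ (ins_op insP (comp_deg hu)) hI) mul1r scalerDr !scalerA.
by congr (_ *: _ + _ *: _); apply: mulrC.
Qed.

End Curvature.

Theorem theorem42 (K : fieldType) (charK : [pchar K] =i pred0)
    (A : gcAlgebra K) (L : gMod A)
    (X : seq L -> L) (symb : seq L -> A -> A) (LR : LRinfty X symb)
    (P : gMod A) (nabla : seq L -> P -> P) (conn : connection symb nabla)
    (S : symAlgebra L)
    (ins : S -> Forms L P -> Forms L P) (insP : insertion ins)
    (Lam : seq S -> S) (LamP : bracket X symb Lam) :
  let Lnabla : seq S -> Forms L P -> Forms L P := Lconn X nabla S ins in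
  [/\ @connection K (groundAlg K) (groundMod S) (fun _ _ => 0)
        (groundMod (Forms L P)) Lnabla,
      forall (us : seq S) (Om : Forms L P),
        homogl S us -> homog (Forms L P) Om ->
        curv S (Forms L P) Lam Lnabla us Om
        = - ((-1) ^+ (size us).+1 : K) *:
            icomm S ins 2 (Jop X nabla (size us).+1) us Om,
      forall (us : seq S) (u : S) (Om : Forms L P),
        homogl S us -> homog S u -> homog (Forms L P) Om ->
        Lnabla us (ins u Om)
        = ins (Lam (rcons us u)) Om
          + sgn (deg S u * (sdeg S us + 1)) *: ins u (Lnabla us Om) &
      forall (u u1 : S) (us : seq S) (Om : Forms L P),
        homog S u -> homog S u1 -> homogl S us -> homog (Forms L P) Om ->
        Lnabla (u * u1 :: us) Om
        = sgn (deg S u) *: ins u (Lnabla (u1 :: us) Om)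
          + sgn (deg S u1 * sdeg S us) *: Lnabla (u :: us) (ins u1 Om)].
Proof.
move=> Lnabla; split; first exact: (Lconn_connection LR conn insP).
- move=> us Om hus [d hO]; exact: (Lconn_curvature charK LR conn insP LamP hus hO).
- move=> us u Om hus hu [d hO]; exact: (Lconn_ins LR conn insP LamP hus hu hO).
move=> u u1 us Om hu hu1 hus [d hO]; exact: (Lconn_mul LR conn insP hu hu1 hus hO).
Qed.
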